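(* Let $X$ be a random variable with distribution function $F$ (with all moments finite), where $F$ has an unbounded support $\mathrm{supp}(F)\subset\mathbb{R}$ and its moments $m_{2k}=\mathbf{E}[X^{2k}]$ satisfy $m_{2k}=\mathcal{O}((2k)^{2ak})$ as $k\to\infty$ for some constant $a\in(0,1]$. Then the following statements hold. (i) $X$ satisfies Cramér's condition and hence is M-det. (ii) The boundary value $a=1$ is the best possible for $X$ to be M-det. In fact, there is an M-indet random variable $\tilde X$ such that $\mathbf{E}[\tilde X^{2k}]=\mathcal{O}((2k)^{2ak})$ as $k\to\infty$ for all $a>1$.
   Context: All random variables are assumed to have finite moments of all positive orders. A random variable $X$ with distribution function $F$ and moments $m_k=\mathbf{E}[X^k]$ is called moment determinate (M-det) if $F$ is the only distribution having the moment sequence $\{m_k\}_{k=1}^\infty$; otherwise it is called moment indeterminate (M-indet). $X$ satisfies Cramér's condition if its moment generating function exists, i.e. $\mathbf{E}[e^{tX}]<\infty$ for all $t$ in some open neighbourhood of $0$. *)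

(* Defs.v *)
(* MathComp-Analysis *)
From HB Require Import structures.
From mathcomp Require Import all_boot all_order all_algebra.
From mathcomp Require Import all_classical all_reals all_analysis.

Set Implicit Arguments.
Unset Strict Implicit.
Unset Printing Implicit Defensive.

Import Order.TTheory GRing.Theory Num.Theory.
Import numFieldNormedType.Exports.

Local Open Scope classical_set_scope.
Local Open Scope ring_scope.

Section moments.
Context {d : measure_display} {T : measurableType d} {R : realType}.
Variables (P : probability T R) (X : T -> R).

Definition moment (k : nat) : \bar R := ('E_P[fun w => (X w ^+ k)%R])%E.

Definition finite_moments : Prop :=
  forall k : nat, P.-integrable [set: T] (fun w => (X w ^+ k)%:E).

Definition cramer : Prop := \forall t \near (0 : R), ('M_P X t < +oo)%E.

End moments.

(* The topological support of a measure on the line; open balls of R are the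
   intervals ]x - e, x + e[. *)
Definition supp {R : realType} (mu : set R -> \bar R) : set R :=
  [set x | forall e : R, 0 < e -> (0 < mu (ball x e))%E].

(* Distributions are the Borel probability measures nu on R; their moments are
   those of the identity under nu.  All moments of nu are required to be
   finite because 'E_nu is a total operator. *)
Definition M_det {d : measure_display} {T : measurableType d} {R : realType}
    (P : probability T R) (X : {RV P >-> R}) : Prop :=
  forall nu : probability R R,
    finite_moments nu (fun x : R => x) ->
    (forall k : nat, (0 < k)%N -> moment nu (fun x : R => x) k = moment P X k) ->
    forall A : set R, measurable A -> nu A = distribution P X A.

Definition M_indet {d : measure_display} {T : measurableType d} {R : realType}
    (P : probability T R) (X : {RV P >-> R}) : Prop := ~ M_det X.

(* m_{2k} = O((2k)^{2ak}) as k -> oo; [fine] is harmless under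
   [finite_moments], which accompanies every use. *)
Definition even_moments_bigO {d : measure_display} {T : measurableType d}
    {R : realType} (P : probability T R) (X : {RV P >-> R}) (a : R) : Prop :=
  (fun k : nat => fine (moment P X (2 * k)%N) : R) =O_\oo
  (fun k : nat => ((2 * k)%N%:R `^ (2 * a * k%:R) : R)).

(* Main.v *)
Require Import Defs.
From HB Require Import structures.
From mathcomp Require Import all_boot all_order all_algebra.
From mathcomp Require Import all_classical all_reals all_analysis.
From mathcomp Require Import measurable_realfun.
From mathcomp Require Import ring lra zify.

(** Cramer's condition. Since n^n <= n! e^n, a bound m_2k <= K (2k)^(2k) makes
    the series of E[exp(tX) + exp(-tX)] converge geometrically as soon as
    t e < 1 ([exp_integrable]).

    Determinacy. Let mu and nu have the same moments and integrate
    exp(t0 |x|). Call a bounded g a test function when mu and nu agree on p g for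
    every polynomial p. Expanding the sine in its Taylor series and integrating
    termwise shows that test functions are stable under multiplication by
    sin(t (x - a)) for small t ([agree_sin]), hence under multiplication by any
    polynomial in that sine. Suitable such polynomials tend boundedly to the
    indicator of the set where the sine is positive, and as t tends to 0 these
    sets fill the ray x > a. So mu and nu agree on all rays ([same_rays]). This
    goes straight from the moments to the measures, without characteristic
    functions.

    Sharpness. The indeterminate law lives on the integers. Put
    w(n) = prod_j sinc(c_j n)^2 with sum_j 2 c_j <= 1. Then n^(2k) w(n) is a
    superposition of the cosines cos(n y) with |y| <= 1, because each factor
    n^2 sinc(c n)^2 is sin(c n)^2 / c^2 ([mixture_weight]). Twisting by (-1)^n
    moves these frequencies away from 0 modulo 2 pi, so that the Fejer sums of
    (-1)^n n^(2k) w(n) over all integers stay bounded, and the sum itself, being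
    their Cesaro limit, vanishes ([alternating_sum_eq0]). Hence the laws with
    masses proportional to w(n) and to (1 + (-1)^n) w(n) have the same moments,
    although they differ at 0. The same superposition bounds n^(2k) w(n) by
    prod_(j < k) c_j^-2. For c_j of the order of 1 / (j (ln j)^2), which is
    summable, this product is O((2k)^(2ak)) for every a > 1
    ([prod_log_scale_bigO]). *)

Set Implicit Arguments.
Unset Strict Implicit.
Unset Printing Implicit Defensive.

Import Order.TTheory GRing.Theory Num.Theory.
Import numFieldNormedType.Exports.

Local Open Scope classical_set_scope.
Local Open Scope ring_scope.

(** * Exponential moments from moment growth *)

Lemma eseries_EFin (R : realType) (u : R^nat) : cvgn (series u) ->
  (\sum_(k <oo) (u k)%:E)%E = (limn (series u))%:E.
Proof.
move=> cu; rewrite -EFin_lim//; congr (limn _).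
by apply/funext => n /=; rewrite sumEFin.
Qed.

Lemma natX_le_fact_expR (R : realType) (n : nat) :
  (n%:R ^+ n : R) <= n`!%:R * expR 1 ^+ n.
Proof.
case: n => [|n]; first by rewrite !expr0 fact0 mulr1.
have := @expR_ge1Dxn R n.+1%:R n (ler0n _ _).
have f0 : (0 : R) < n.+1`!%:R by rewrite ltr0n fact_gt0.
rewrite -expRM_natr mul1r => h.
rewrite mulrC -ler_pdivrMr//; apply: le_trans h.
by rewrite lerDr.
Qed.

(** Twice the series of the hyperbolic cosine, indexed by all n so that it can
    be compared with the exponential series term by term. *)
Lemma expR_even_series (R : realType) (y : R) :
  ((expR y + expR (- y))%:E =
  \sum_(n <oo) (if odd n then 0 else 2 * y ^+ n / n`!%:R)%R%:E)%E.
Proof.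
have c1 := is_cvg_series_exp_coeff y.
have c2 := is_cvg_series_exp_coeff (- y)%R.
rewrite (eq_eseriesr (g := fun n => ((exp_coeff y + exp_coeff (- y)) n)%:E)).
  rewrite eseries_EFin seriesD; first by rewrite limD.
  exact: is_cvgD c1 c2.
move=> n _; rewrite /exp_coeff /=; congr EFin.
rewrite fctE /= exprNn -signr_odd; case: (odd n) => /=; rewrite ?expr0 ?expr1.
  by rewrite mulN1r mulNr subrr.
by rewrite mul1r -mulrDl -mulr2n mulr_natl.
Qed.

Section exponential_moments.
Context {d : measure_display} {T : measurableType d} {R : realType}.
Variables (P : probability T R) (X : T -> R).
Hypothesis mX : measurable_fun setT X.
Local Open Scope ereal_scope.

Lemma even_moment_ge0 (k : nat) : 0 <= moment P X (2 * k)%N.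
Proof.
rewrite /moment unlock; apply: integral_ge0 => w _.
by rewrite lee_fin mulnC exprM sqr_ge0.
Qed.

(** The factorials absorb n^n up to the factor e^n, and the choice t = 1/(2e)
    turns the bound on the n-th term of the series into 2 K 2^-n. *)
Lemma exp_integrable (K : R) : finite_moments P X -> (0 <= K)%R ->
  (forall k : nat, moment P X (2 * k)%N <= (K * (2 * k)%N%:R ^+ (2 * k)%N)%:E) ->
  \int[P]_w (expR ((2 * expR 1)^-1 * X w) +
             expR (- ((2 * expR 1)^-1 * X w)))%:E < +oo.
Proof.
move=> fX K0 mK; set t := ((2 * expR 1)^-1)%R; have e0 := expR_gt0 (1 : R).
have t0 : (0 < t)%R by rewrite invr_gt0 mulr_gt0.
have te : (t * expR 1 = 2^-1)%R by rewrite /t invfM -mulrA mulVf ?gt_eqF// mulr1.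
under eq_integral do rewrite expR_even_series.
have mterm n : measurable_fun [set: T]
    (fun w => (if odd n then 0 else 2 * (t * X w) ^+ n / n`!%:R)%R).
  case: (odd n); first exact: measurable_cst.
  apply: measurable_funM => //; apply: measurable_funM => //.
  by apply: measurable_funX; exact: measurable_funM.
rewrite integral_nneseries//; last 2 first.
  by move=> n; apply/measurable_EFinP; exact: mterm.
  move=> n w _; rewrite lee_fin; case: ifPn => // on.
  by rewrite divr_ge0// mulr_ge0// exprn_even_ge0.
apply: (@le_lt_trans _ _ (\sum_(n <oo) (geometric (2 * K) 2^-1 n)%R%:E)); last first.
  rewrite eseries_EFin ?ltry//; apply: is_cvg_geometric_series.
  by rewrite ger0_norm ?invr_ge0// invf_lt1// ltr1n.
apply: lee_nneseries => [n _|n _].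
  move=> _; apply: integral_ge0 => w _; rewrite lee_fin; case: ifPn => // on.
  by rewrite divr_ge0// mulr_ge0// exprn_even_ge0.
have geo0 : (0 <= geometric (2 * K) 2^-1 n)%R by rewrite geometric_ge0 ?mulr_ge0.
case: (boolP (odd n)) => on; first by rewrite integral0 lee_fin.
have [k nk] : exists k, n = (2 * k)%N.
  by exists n./2; rewrite -[LHS]odd_double_half (negbTE on) add0n mul2n.
have -> : \int[P]_w (2 * (t * X w) ^+ n / n`!%:R)%:E =
    \int[P]_w ((2 * t ^+ n / n`!%:R)%:E * (X w ^+ n)%:E).
  by apply: eq_integral => w _; rewrite -EFinM; congr EFin; rewrite exprMn; ring.
rewrite integralZl//.
have := mK k; rewrite -nk /moment unlock => mKn.
have f0 : (0 < n`!%:R :> R)%R by rewrite ltr0n fact_gt0.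
have t20 : (0 <= 2 * t ^+ n / n`!%:R)%R.
  by rewrite divr_ge0// ?mulr_ge0// exprn_ge0// ltW.
apply: (le_trans (lee_wpmul2l _ mKn)); first by rewrite lee_fin.
rewrite -EFinM lee_fin /geometric/= -te exprMn.
rewrite mulrAC ler_pdivrMr//.
have := natX_le_fact_expR R n => h.
have -> : (2 * t ^+ n * (K * n%:R ^+ n) = 2 * K * t ^+ n * n%:R ^+ n)%R by ring.
have -> : (2 * K * (t ^+ n * expR 1 ^+ n) * n`!%:R =
  2 * K * t ^+ n * (n`!%:R * expR 1 ^+ n))%R by ring.
by rewrite ler_wpM2l// !mulr_ge0// exprn_ge0// ltW.
Qed.

Lemma cramer_of_exp_integrable (t : R) : (0 < t)%R ->
  \int[P]_w (expR (t * X w) + expR (- (t * X w)))%:E < +oo -> cramer P X.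
Proof.
move=> t0 It; rewrite /cramer; apply: filterS (@nbhs0_le _ R^o t t0) => s st.
apply: le_lt_trans It; rewrite /mmt_gen_fun unlock.
apply: ge0_le_integral => //=.
- by apply/measurable_EFinP; apply: measurableT_comp => //; exact: measurable_funM.
- apply/measurable_EFinP; apply: measurable_funD.
    by apply: measurableT_comp => //; exact: measurable_funM.
  by do 2 apply: measurableT_comp => //; exact: measurable_funM.
move=> w _; rewrite lee_fin.
have : (X w * s <= `|t * X w|)%R.
  rewrite (le_trans (ler_norm _))// !normrM mulrC ler_wpM2r//.
  by rewrite (ger0_norm (ltW t0)).
rewrite -ler_expR => /le_trans; apply.
by case: (ger0P (t * X w)%R) => _; rewrite ?lerDl ?lerDr.
Qed.

End exponential_moments.

(** The finitely many moments that the asymptotic bound misses are absorbed in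
    the constant, as (2k)^(2k) >= 1. *)
Lemma even_moments_bound (d : measure_display) (T : measurableType d)
    (R : realType) (P : probability T R) (X : {RV P >-> R}) (a : R) :
  finite_moments P X -> a <= 1 ->
  even_moments_bigO X a ->
  exists2 K : R, (0 <= K)%R &
    forall k : nat, (moment P X (2 * k)%N <= (K * (2 * k)%N%:R ^+ (2 * k)%N)%:E)%E.
Proof.
move=> fX a1 /eqO_exP[C C0 [N _ NC]].
have m_ge0 k : (0 <= fine (moment P X (2 * k)%N))%R.
  exact/fine_ge0/even_moment_ge0.
have mE k : moment P X (2 * k)%N = (fine (moment P X (2 * k)%N))%:E.
  rewrite fineK// /moment unlock; exact: integrable_fin_num (fX _).
exists (C + \sum_(j < N) fine (moment P X (2 * j)%N))%R.
  by rewrite addr_ge0 ?(ltW C0)// sumr_ge0.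
move=> k; rewrite mE lee_fin.
have p1 : (1 <= (2 * k)%N%:R ^+ (2 * k)%N :> R)%R.
  case: k => [|k]; first by rewrite muln0 expr0.
  by rewrite exprn_ege1// ler1n muln_gt0.
have [kN|kN] := ltnP k N.
  rewrite (le_trans _ (ler_peMr _ p1))//; last first.
    by rewrite addr_ge0 ?(ltW C0)// sumr_ge0.
  rewrite (bigD1 (Ordinal kN))//= addrCA lerDl addr_ge0 ?(ltW C0)//.
  by rewrite sumr_ge0.
have := NC k kN => /=; rewrite ger0_norm// => /le_trans; apply.
rewrite ger0_norm ?powR_ge0// ler_pM ?powR_ge0 ?(ltW C0)//.
  by rewrite lerDl sumr_ge0.
case: k p1 {kN} => [|k] p1; first by rewrite mulr0 powRr0.
rewrite -powR_mulrn// ler_powR ?ler1n ?muln_gt0//.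
by rewrite natrM ler_wpM2r// -[leRHS]mulr1 ler_wpM2l.
Qed.

(** * Polynomials approaching the indicator of a half-interval *)

Lemma bernoulli_ge (R : realType) (x : R) (n : nat) :
  -1 <= x -> 1 + n%:R * x <= (1 + x) ^+ n.
Proof.
move=> x1; elim: n => [|n ih]; first by rewrite mul0r addr0 expr0.
rewrite exprS; apply: (@le_trans _ _ ((1 + x) * (1 + n%:R * x))).
  rewrite -natr1 mulrDl mul1r mulrDr mulr1 -subr_ge0.
  have -> : 1 + x + (1 + x) * (n%:R * x) - (1 + (n%:R * x + x)) = n%:R * x ^+ 2.
    by ring.
  by rewrite mulr_ge0// sqr_ge0.
by apply: ler_wpM2l => //; lra.
Qed.

(** With s the square root of r, the factor n s^n is bounded by Bernoulli's
    inequality and the other factor s^n tends to 0. *)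
Lemma cvg_natM_expr (R : realType) (r : R) : 0 <= r -> r < 1 ->
  (fun n : nat => n%:R * r ^+ n) @ \oo --> (0 : R).
Proof.
move=> r0 r1; have [->|rn0] := eqVneq r 0.
  apply: cvg_near_cst; near=> n; rewrite expr0n gtn_eqF ?mulr0//.
  by near: n; exists 1%N.
pose s := Num.sqrt r.
have rgt0 : 0 < r by rewrite lt_def rn0.
have s0 : 0 < s by rewrite sqrtr_gt0.
have s1 : s < 1 by rewrite -sqrtr1 ltr_sqrt.
have ss : r = s * s by rewrite -expr2 sqr_sqrtr.
pose h := s^-1 - 1.
have h0 : 0 < h by rewrite subr_gt0 invf_gt1.
have b n : n%:R * s ^+ n <= h^-1.
  have hge : -1 <= h by rewrite (le_trans _ (ltW h0))// lerN10.
  have h1 : 1 + h = s^-1 by rewrite /h addrC subrK.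
  have := bernoulli_ge n hge; rewrite h1 => B.
  have sn0 : 0 < s ^+ n by rewrite exprn_gt0.
  rewrite -ler_pdivlMr// -(ler_pM2r h0) mulrAC mulVf ?gt_eqF// mul1r -exprVn.
  by rewrite (le_trans _ B)// lerDr.
apply: (@squeeze_cvgr _ _ _ _ (cst 0) (fun n => h^-1 * s ^+ n)).
- near=> n; rewrite mulr_ge0//= ?exprn_ge0//.
  by rewrite ss exprMn mulrA ler_wpM2r// exprn_ge0// ltW.
- exact: cvg_cst.
- rewrite -(mulr0 h^-1); apply: cvgM; first exact: cvg_cst.
  by apply: cvg_expr; rewrite ger0_norm// ltW.
Unshelve. all: by end_near. Qed.

(** On [0, 1] these polynomials tend to the indicator of [0, 1/2[: (1 - y^n)^N
    is near 1 when N y^n is small and near 0 when N y^n is large, and the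
    exponent N = n 2^n puts the threshold at 1/2; the factor n decides the
    threshold itself. *)
Definition steep {R : realType} (n : nat) (y : R) : R :=
  (1 - y ^+ n) ^+ (n * 2 ^ n).

Lemma steep_itv (R : realType) (n : nat) (y : R) : 0 <= y <= 1 ->
  0 <= steep n y <= 1.
Proof.
move=> /andP[y0 y1]; have yn0 : 0 <= y ^+ n by rewrite exprn_ge0.
have yn1 : y ^+ n <= 1 by rewrite exprn_ile1.
by rewrite exprn_ge0 ?subr_ge0//= exprn_ile1 ?subr_ge0// lerBlDr lerDl.
Qed.

Lemma cvg_steep1 (R : realType) (y : R) : 0 <= y -> y < 2^-1 ->
  (fun n => steep n y) @ \oo --> (1 : R).
Proof.
move=> y0 y2; have y1 : y <= 1 by rewrite (le_trans (ltW y2))// invf_le1// ler1n.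
apply: (@squeeze_cvgr _ _ _ _ (fun n => 1 - n%:R * (2 * y) ^+ n) (cst 1)).
- near=> n; have y01 : 0 <= y <= 1 by rewrite y0.
  have /andP[_ ->] := steep_itv n y01.
  have yn1 : y ^+ n <= 1 by rewrite exprn_ile1.
  have := @bernoulli_ge R (- y ^+ n) (n * 2 ^ n); rewrite lerN2 => /(_ yn1) B.
  rewrite andbT (le_trans _ B)// natrM natrX exprMn.
  by rewrite mulrN lerD2l lerN2 mulrA.
- rewrite -[X in _ --> X]subr0; apply: cvgB; first exact: cvg_cst.
  by apply: cvg_natM_expr; [exact: mulr_ge0|rewrite mulrC -ltr_pdivlMr// mul1r].
- exact: cvg_cst.
Unshelve. all: by end_near. Qed.

Lemma cvg_steep0 (R : realType) (y : R) : 2^-1 <= y -> y <= 1 ->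
  (fun n => steep n y) @ \oo --> (0 : R).
Proof.
move=> y2 y1; have y0 : 0 <= y by rewrite (le_trans _ y2)// invr_ge0.
apply: (@squeeze_cvgr _ _ _ _ (cst 0) (fun n => n.+1%:R^-1)).
- near=> n; have y01 : 0 <= y <= 1 by rewrite y0.
  have /andP[st0 _] := steep_itv n y01; rewrite st0.
  rewrite /=; have yn0 : 0 <= y ^+ n by rewrite exprn_ge0.
  have yn1 : y ^+ n <= 1 by rewrite exprn_ile1.
  have Yge : -1 <= y ^+ n by rewrite (le_trans _ yn0)// lerN10.
  have := @bernoulli_ge R (y ^+ n) (n * 2 ^ n) Yge => B.
  have nB : n.+1%:R <= (1 + y ^+ n) ^+ (n * 2 ^ n).
    rewrite (le_trans _ B)// -natr1 addrC lerD2l natrM natrX -mulrA -exprMn.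
    by rewrite ler_peMr// exprn_ege1// mulrC -ler_pdivrMr// mul1r.
  rewrite -[leRHS]mul1r ler_pdivlMr//.
  rewrite (le_trans (ler_wpM2l st0 nB))//.
  rewrite /steep -exprMn exprn_ile1//.
    by rewrite mulr_ge0// ?subr_ge0// addr_ge0.
  by rewrite -subr_sqr expr1n lerBlDr lerDl exprn_ge0.
- exact: cvg_cst.
- exact: cvg_harmonic.
Unshelve. all: by end_near. Qed.

(** * Determinacy from exponential moments *)

Definition bounded_real {R : realType} (g : R -> R) :=
  exists C : R, forall x, `|g x| <= C.

Section polynomial_integrals.
Context {R : realType} (mu : probability R R).
Hypothesis fmu : finite_moments mu (fun x : R => x).

Lemma measurable_horner (p : {poly R}) : measurable_fun setT (horner p).
Proof.
rewrite (_ : horner p = fun x => \sum_(i < size p) p`_i * x ^+ i); last first.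
  by apply/funext => x; rewrite horner_coef.
by apply: measurable_sum => i; apply: measurable_funM => //; exact: exprn_measurable.
Qed.

Lemma integrable_horner (p : {poly R}) :
  mu.-integrable setT (EFin \o horner p).
Proof.
rewrite (_ : EFin \o horner p =
    fun x => (\sum_(i < size p) (p`_i)%:E * (x ^+ i)%:E)%E); last first.
  apply/funext => x /=; rewrite horner_coef -sumEFin.
  by apply: eq_bigr => i _; rewrite EFinM.
by apply: integrable_sum => // i _; apply: integrableZl => //; exact: fmu.
Qed.

Lemma integrable_hornerM (p : {poly R}) (g : R -> R) :
  measurable_fun setT g -> bounded_real g ->
  mu.-integrable setT (fun x => (p.[x] * g x)%:E).
Proof.
move=> mg [C gC]; rewrite (_ : (fun x => _) =
    ((EFin \o g) \* (EFin \o horner p))%E).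
  apply: integrableMr => //; last exact: integrable_horner.
  exists C; split; first exact: num_real.
  by move=> M CM x _ /=; rewrite (le_trans (gC x))// ltW.
by apply/funext => x /=; rewrite mulrC EFinM.
Qed.

End polynomial_integrals.

Lemma horner_le_expR (R : realType) (p : {poly R}) (h : R) : 0 < h ->
  exists2 C : R, 0 <= C & forall x, `|p.[x]| <= C * expR (h * `|x|).
Proof.
elim/poly_ind: p h => [|q c ih] h h0.
  by exists 0 => // x; rewrite horner0 normr0 mul0r.
have h20 : 0 < h / 2 by rewrite divr_gt0.
have [C C0 qC] := ih _ h20.
exists (C * (h / 2)^-1 + `|c|); first by rewrite addr_ge0// mulr_ge0// invr_ge0 ltW.
move=> x; rewrite hornerMXaddC (le_trans (ler_normD _ _))// mulrDl lerD//; last first.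
  by rewrite ler_peMr// -expR0 ler_expR mulr_ge0// ltW.
rewrite normrM (le_trans (ler_wpM2r _ (qC x)))//.
rewrite -[leLHS]mulrA -[leRHS]mulrA; apply: ler_wpM2l => //.
have -> : h * `|x| = h / 2 * `|x| + h / 2 * `|x| by rewrite -mulrDl -splitr.
rewrite expRD [leRHS]mulrCA; apply: ler_wpM2l; first exact: expR_ge0.
rewrite -ler_pdivrMl ?invr_gt0// invrK.
by rewrite (le_trans _ (expR_ge1Dx _))// lerDr.
Qed.

Lemma series_sin_coeff_le (R : realType) (y : R) (n : nat) :
  `|series (sin_coeff y) n| <= expR `|y|.
Proof.
apply: (@le_trans _ _ (series (exp_coeff `|y|) n)).
  rewrite /series /= (le_trans (ler_norm_sum _ _ _))//; apply: ler_sum => i _.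
  rewrite /exp_coeff /= !normrM normrX normfV !normrX normrN normr1 expr1n mulr1.
  rewrite !normr_nat ler_wpM2r ?invr_ge0//.
  by case: (odd i); rewrite ?mul1r ?mul0r// exprn_ge0.
apply: nondecreasing_cvgn_le; last exact: is_cvg_series_exp_coeff.
apply/nondecreasing_seqP => k; rewrite /series /= big_nat_recr//= lerDl.
exact: exp_coeff_ge0.
Qed.

Section determinacy.
Context {R : realType} (mu nu : probability R R).
Hypotheses (fmu : finite_moments mu (fun x : R => x))
           (fnu : finite_moments nu (fun x : R => x)).
Variable t0 : R.
Hypothesis t0_gt0 : 0 < t0.
Hypotheses
  (emu : (\int[mu]_x (expR (t0 * x) + expR (- (t0 * x)))%:E < +oo)%E)
  (enu : (\int[nu]_x (expR (t0 * x) + expR (- (t0 * x)))%:E < +oo)%E).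
Hypothesis mom : forall k : nat, (0 < k)%N ->
  moment nu (fun x : R => x) k = moment mu (fun x : R => x) k.

Lemma same_poly_integrals (p : {poly R}) :
  (\int[mu]_x (p.[x])%:E = \int[nu]_x (p.[x])%:E)%E.
Proof.
have E (m : probability R R) : finite_moments m (fun x : R => x) ->
    (\int[m]_x (p.[x])%:E =
     \sum_(i < size p) (p`_i)%:E * moment m (fun x : R => x) i)%E.
  move=> fm; under eq_integral do rewrite horner_coef -sumEFin.
  rewrite integral_sum//=; last first.
    move=> i; under eq_fun do rewrite EFinM.
    by apply: integrableZl => //; exact: fm.
  apply: eq_bigr => i _; rewrite /moment unlock.
  under eq_integral do rewrite EFinM.
  by rewrite integralZl//; exact: fm.
rewrite !E//; apply: eq_bigr => -[[|i] /= _] _; last by rewrite mom.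
rewrite /moment unlock; congr (_ * _)%E.
under eq_integral do rewrite expr0.
under [RHS]eq_integral do rewrite expr0.
rewrite !integral_cst// !mul1e; apply: etrans (esym (probability_setT nu)).
exact: (probability_setT mu).
Qed.

(** The polynomial factor is built in so that the class is stable under
    multiplication by a bounded limit of polynomials, such as the sine. *)
Definition agree (g : R -> R) := [/\ measurable_fun setT g, bounded_real g &
  forall p : {poly R}, (\int[mu]_x (p.[x] * g x)%:E = \int[nu]_x (p.[x] * g x)%:E)%E].

Lemma agree1 : agree (fun=> 1).
Proof.
split=> //; first by exists 1 => x; rewrite normr1.
move=> p; under eq_integral do rewrite mulr1.
by under [RHS]eq_integral do rewrite mulr1; exact: same_poly_integrals.
Qed.

Lemma agree_lin (a : R) (f g : R -> R) : agree f -> agree g ->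
  agree (fun x => a * f x + g x).
Proof.
move=> [mf bf If] [mg bg Ig]; split.
- by apply: measurable_funD => //; exact: measurable_funM.
- case: bf bg => [C fC] [D gD]; exists (`|a| * C + D) => x.
  by rewrite (le_trans (ler_normD _ _))// lerD// normrM ler_wpM2l.
move=> p.
have E (m : probability R R) : finite_moments m (fun x : R => x) ->
    (\int[m]_x (p.[x] * (a * f x + g x))%:E =
     a%:E * \int[m]_x (p.[x] * f x)%:E + \int[m]_x (p.[x] * g x)%:E)%E.
  move=> fm; have If' := integrable_hornerM fm p mf bf.
  have Ig' := integrable_hornerM fm p mg bg.
  rewrite -integralZl// -integralD//; last exact: integrableZl.
  by apply: eq_integral => x _; rewrite -EFinM -EFinD; congr EFin; ring.
by rewrite !E// If Ig.
Qed.

(** The Taylor series of the sine is integrated term by term: its partial sums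
    are polynomials, so mu and nu agree on them, and they are dominated by
    exp(t |x|) up to a constant. The polynomial factor p costs another
    exp(t |x|), whence the condition 2 t <= t0. *)
Lemma agree_sin (t a : R) (g : R -> R) : 0 < t -> 2 * t <= t0 ->
  agree g -> agree (fun x => sin (t * (x - a)) * g x).
Proof.
move=> t_gt0 tt0 [mg [D gD] Ig].
have D0 : 0 <= D by rewrite (le_trans _ (gD 0)).
have msin : measurable_fun setT (fun x : R => sin (t * (x - a))).
  apply: measurableT_comp; first exact: (continuous_measurable_fun (@continuous_sin R)).
  by apply: measurable_funM => //; exact: measurable_funB.
split.
- exact: measurable_funM.
- exists D => x; rewrite normrM -[leRHS]mul1r ler_pM//; exact: sin_max.
move=> p; have [C C0 pC] := horner_le_expR p t_gt0.
pose q n : {poly R} := \sum_(0 <= k < n)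
  ((odd k)%:R * (-1) ^+ k.-1./2 / k`!%:R) *: (t *: ('X - a%:P)) ^+ k.
have qE n x : (q n).[x] = series (sin_coeff (t * (x - a))) n.
  rewrite /q horner_sum /series /=; apply: eq_bigr => k _.
  by rewrite hornerZ horner_exp hornerZ hornerXsubC /sin_coeff/= mulrAC.
pose f n (x : R) := ((q n * p).[x] * g x)%:E.
pose K := C * D * expR (t * `|a|).
pose dom (x : R) := (K * (expR (t0 * x) + expR (- (t0 * x))))%:E.
have K0 : 0 <= K by rewrite !mulr_ge0// expR_ge0.
have L (m : probability R R) : finite_moments m (fun x : R => x) ->
    (\int[m]_x (expR (t0 * x) + expR (- (t0 * x)))%:E < +oo)%E ->
    (fun n => (\int[m]_x f n x)%E) @ \oo -->
      (\int[m]_x (p.[x] * (sin (t * (x - a)) * g x))%:E)%E.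
  move=> fm em.
  have bg : bounded_real g by exists D.
  have mexp (s : R) : measurable_fun setT (fun x : R => expR (s * x)).
    by apply: measurableT_comp => //; exact: measurable_funM.
  have mch : measurable_fun setT (fun x : R => expR (t0 * x) + expR (- (t0 * x))).
    apply: measurable_funD; first exact: mexp.
    by under eq_fun do rewrite -mulNr; exact: mexp.
  have [] // := @dominated_convergence _ _ _ m setT measurableT f
    (fun x => (p.[x] * (sin (t * (x - a)) * g x))%:E) dom.
  - by move=> n; have /measurable_int := integrable_hornerM fm (q n * p) mg bg.
  - apply/measurable_EFinP; apply: measurable_funM; first exact: measurable_horner.
    exact: measurable_funM.
  - apply: aeW => x _; rewrite /f; under eq_fun do rewrite hornerM qE.
    apply: cvg_EFin; first exact: nearW.
    rewrite [X in _ --> X](_ : _ = sin (t * (x - a)) * p.[x] * g x); last by ring.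
    apply: cvgM; last exact: cvg_cst.
    apply: cvgM; last exact: cvg_cst.
    by rewrite unlock; exact: is_cvg_series_sin_coeff.
  - rewrite /dom; under eq_fun do rewrite EFinM.
    apply: integrableZl => //; apply/integrableP; split; first exact/measurable_EFinP.
    rewrite (eq_integral (fun x => (expR (t0 * x) + expR (- (t0 * x)))%:E))// => x _ /=.
    by rewrite ger0_norm// addr_ge0// expR_ge0.
  - apply: aeW => x n _; rewrite /f /dom /= lee_fin hornerM qE !normrM.
    have e1 : expR `|t * (x - a)| <= expR (t * `|x|) * expR (t * `|a|).
      rewrite -expRD ler_expR normrM (gtr0_norm t_gt0) -mulrDr ler_wpM2l ?(ltW t_gt0)//.
      exact: ler_normB.
    have e2 : expR (t * `|x|) * expR (t * `|x|) <= expR (t0 * x) + expR (- (t0 * x)).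
      rewrite -expRD -mulrDl -mulr2n -mulr_natl.
      apply: (@le_trans _ _ (expR (`|t0 * x|))).
        by rewrite ler_expR normrM (gtr0_norm t0_gt0) ler_wpM2r.
      by case: (ger0P (t0 * x)) => _; rewrite ?lerDl ?lerDr expR_ge0.
    have s1 := le_trans (series_sin_coeff_le (t * (x - a)) n) e1.
    apply: (@le_trans _ _ (expR (t * `|x|) * expR (t * `|a|) *
                           (C * expR (t * `|x|)) * D)).
      by rewrite ler_pM// ?mulr_ge0// ler_pM.
    rewrite [leLHS](_ : _ = K * (expR (t * `|x|) * expR (t * `|x|))).
      by rewrite ler_wpM2l.
    by rewrite /K; ring.
have := L nu fnu enu; rewrite (_ : (fun n => _) = (fun n => (\int[mu]_x f n x)%E)).
  by move=> Lnu; apply: (cvg_unique _ (L mu fmu emu) Lnu).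
by apply/funext => n; rewrite /f Ig.
Qed.

Definition multiplier (u : R -> R) :=
  forall g, agree g -> agree (fun x => u x * g x).

Lemma multiplierX (u : R -> R) (n : nat) : multiplier u ->
  multiplier (fun x => u x ^+ n).
Proof.
move=> mu_ g ag; elim: n => [|n ih].
  by under eq_fun do rewrite expr0 mul1r.
by under eq_fun do rewrite exprS -mulrA; exact: mu_.
Qed.

Lemma multiplier1B (u : R -> R) : multiplier u -> multiplier (fun x => 1 - u x).
Proof.
move=> mu_ g ag; rewrite (_ : (fun x => _) = (fun x => -1 * (u x * g x) + g x)).
  by apply: agree_lin => //; exact: mu_.
by apply/funext => x; ring.
Qed.

(** The affine change brings the sine into [0, 1], with the threshold 1/2 where
    the sine vanishes. *)
Lemma multiplier_half_sin (t a : R) : 0 < t -> 2 * t <= t0 ->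
  multiplier (fun x => (1 - sin (t * (x - a))) / 2).
Proof.
move=> t_gt0 tt0 g ag.
rewrite (_ : (fun x => _) = (fun x => - 2^-1 * (sin (t * (x - a)) * g x) +
   (- 2^-1 * g x + g x))).
  by apply: agree_lin; [exact: agree_sin|exact: agree_lin].
by apply/funext => x; field.
Qed.

End determinacy.

Section determinacy_intervals.
Context {R : realType} (mu nu : probability R R).
Hypotheses (fmu : finite_moments mu (fun x : R => x))
           (fnu : finite_moments nu (fun x : R => x)).
Variable t0 : R.
Hypothesis t0_gt0 : 0 < t0.
Hypotheses
  (emu : (\int[mu]_x (expR (t0 * x) + expR (- (t0 * x)))%:E < +oo)%E)
  (enu : (\int[nu]_x (expR (t0 * x) + expR (- (t0 * x)))%:E < +oo)%E).
Hypothesis mom : forall k : nat, (0 < k)%N ->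
  moment nu (fun x : R => x) k = moment mu (fun x : R => x) k.

Lemma same_steep_integrals (t a : R) (n : nat) : 0 < t -> 2 * t <= t0 ->
  (\int[mu]_x (steep n ((1 - sin (t * (x - a))) / 2))%:E =
   \int[nu]_x (steep n ((1 - sin (t * (x - a))) / 2))%:E)%E.
Proof.
move=> t_gt0 tt0.
have mult := multiplier_half_sin fmu fnu t0_gt0 emu enu a t_gt0 tt0.
have [_ _ /(_ 1)] := multiplierX (n * 2 ^ n)
  (multiplier1B fmu fnu (multiplierX n mult)) (agree1 fmu fnu mom).
by congr (_ = _); apply: eq_integral => x _; rewrite hornerC mul1r mulr1.
Qed.

Lemma bounded_limit_integrals (m : probability R R) (f : (R -> R)^nat) (A : set R) :
  measurable A -> (forall n, measurable_fun setT (f n)) ->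
  (forall n x, 0 <= f n x <= 1) ->
  (forall x, (fun n => f n x) @ \oo --> (\1_A x : R)) ->
  (fun n => \int[m]_x (f n x)%:E)%E @ \oo --> m A.
Proof.
move=> mA mf f01 fA; have [] // := @dominated_convergence _ _ _ m setT measurableT
  (fun n x => (f n x)%:E) (fun x => (\1_A x)%:E) (cst 1%:E).
- by move=> n; exact/measurable_EFinP.
- by apply/measurable_EFinP; exact: measurable_indic.
- by apply: aeW => x _; apply: cvg_EFin; [exact: nearW|exact: fA].
- exact: finite_measure_integrable_cst.
- apply: aeW => x n _; have /andP[f0 f1] := f01 n x.
  by rewrite /= lee_fin ger0_norm.
by rewrite integral_indic// setIT.
Qed.

(** The steep polynomials in (1 - sin) / 2 tend to the indicator of the set
    where that quantity is less than 1/2. *)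
Lemma same_sin_sets (t a : R) : 0 < t -> 2 * t <= t0 ->
  mu [set x | 0 < sin (t * (x - a))] = nu [set x | 0 < sin (t * (x - a))].
Proof.
move=> t_gt0 tt0; pose u (x : R) := (1 - sin (t * (x - a))) / 2.
have msin : measurable_fun setT (fun x : R => sin (t * (x - a))).
  apply: measurableT_comp; first exact: (continuous_measurable_fun (@continuous_sin R)).
  by apply: measurable_funM => //; exact: measurable_funB.
have u01 x : 0 <= u x <= 1.
  have := sin_geN1 (t * (x - a)); have := sin_le1 (t * (x - a)); rewrite /u.
  by move=> h1 h2; apply/andP; split; lra.
have mA : measurable [set x | 0 < sin (t * (x - a))].
  rewrite -[X in measurable X]setTI.
  by apply: (measurable_fun_ltr (f := cst 0)) => //; exact: measurable_cst.
have L (m : probability R R) := @bounded_limit_integrals m (fun n x => steep n (u x))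
  _ mA.
have {L}L (m : probability R R) : (fun n => \int[m]_x (steep n (u x))%:E)%E @ \oo -->
    m [set x | 0 < sin (t * (x - a))].
  apply: L.
  - move=> n; apply: measurable_funX; apply: measurable_funB => //.
    by apply: measurable_funX; apply: measurable_funM => //; exact: measurable_funB.
  - by move=> n x; exact: steep_itv.
  move=> x; have /andP[u0 u1] := u01 x.
  rewrite indicE; have [sx|sx] := ltP 0 (sin (t * (x - a))).
    rewrite mem_set//; apply: cvg_steep1 => //.
    by rewrite /u ltr_pdivrMr// mulVf// ltrBlDr ltrDl.
  rewrite memNset; last by apply/negP; rewrite -leNgt.
  apply: cvg_steep0 => //.
  by rewrite /u ler_pdivlMr// mulVf// lerBrDr gerDl.
have := L nu; rewrite (_ : (fun n => _) = (fun n => \int[mu]_x (steep n (u x))%:E)%E).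
  by move=> Lnu; apply: (cvg_unique _ (L mu) Lnu).
by apply/funext => n; rewrite same_steep_integrals.
Qed.

(** As the frequency tends to 0, the first half-period of the sine fills the
    half-line. *)
Lemma same_rays (a : R) : mu `]a, +oo[%classic = nu `]a, +oo[%classic.
Proof.
pose t n : R := t0 / 2 * n.+1%:R^-1.
have t_gt0 n : 0 < t n by rewrite !mulr_gt0// invr_gt0.
have tt0 n : 2 * t n <= t0.
  by rewrite /t mulrA mulrCA mulfV// mulr1 ler_piMr ?(ltW t0_gt0)// invf_le1// ler1n.
have msin n : measurable_fun setT (fun x : R => sin (t n * (x - a))).
  apply: measurableT_comp; first exact: (continuous_measurable_fun (@continuous_sin R)).
  by apply: measurable_funM => //; exact: measurable_funB.
have mA n : measurable [set x | 0 < sin (t n * (x - a))].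
  rewrite -[X in measurable X]setTI.
  by apply: (measurable_fun_ltr (f := cst 0)) => //; exact: measurable_cst.
have L (m : probability R R) : (fun n => m [set x | 0 < sin (t n * (x - a))]) @ \oo -->
    m `]a, +oo[%classic.
  rewrite [X in X @ _ --> _](_ : _ = fun n =>
    \int[m]_x (\1_[set x | 0 < sin (t n * (x - a))] x)%:E)%E; last first.
    by apply/funext => n; rewrite integral_indic// setIT.
  apply: bounded_limit_integrals => //.
  - by move=> n; exact: measurable_indic.
  - by move=> n x; rewrite indicE; case: (_ \in _); rewrite ?lexx ?ler01.
  move=> x; apply: cvg_near_cst; near=> n.
  have small : t n * `|x - a| < pi.
    near: n; have : (fun n => t n * `|x - a|) @ \oo --> (0 : R).
      rewrite -(mul0r `|x - a|); apply: cvgM; last exact: cvg_cst.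
      by rewrite -(mulr0 (t0 / 2)); apply: cvgM; [exact: cvg_cst|exact: cvg_harmonic].
    by move=> /cvgr_lt; apply; exact: pi_gt0.
  rewrite !indicE; congr (_ %:R); congr nat_of_bool; apply/idP/idP => /set_mem /= h.
    apply: mem_set; rewrite /= in_itv/= andbT ltNge; apply/negP => xa.
    move: h; apply/negP; rewrite -leNgt -[t n * _]opprK sinN oppr_le0.
    apply: sin_ge0_pi; rewrite -mulrN opprB mulr_ge0 ?subr_ge0 ?(ltW (t_gt0 n))//=.
    by move: small; rewrite distrC ger0_norm ?subr_ge0// => /ltW.
  apply: mem_set => /=; move: h; rewrite in_itv/= andbT => h.
  apply: sin_gt0_pi; rewrite mulr_gt0 ?subr_gt0//=.
  by move: small; rewrite gtr0_norm ?subr_gt0.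
have := L nu; rewrite (_ : (fun n => _) =
    fun n => mu [set x | 0 < sin (t n * (x - a))]).
  by move=> Lnu; apply: (cvg_unique _ (L mu) Lnu).
by apply/funext => n; rewrite same_sin_sets.
Unshelve. all: by end_near. Qed.

Lemma eq_of_moments (A : set R) : measurable A -> nu A = mu A.
Proof.
move=> mA.
pose G := [set A : set R | exists x, A = `]x, +oo[%classic].
pose g (n : nat) : set R := `](- n%:R), +oo[%classic.
refine (@measure_unique _ R _ G g _ _ _ _ nu mu _ _ A mA).
- exact: RGenOInfty.measurableE.
- move=> _ _ [x ->] [y ->]; exists (Num.max x y); apply/seteqP; split => z /=.
    by rewrite !in_itv/= !andbT gt_max => -[-> ->].
  by rewrite !in_itv/= !andbT gt_max => /andP[-> ->].
- by move=> n; exists (- n%:R).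
- apply/seteqP; split => // x _.
  have xn := archi_boundP (normr_ge0 x).
  exists (Num.Def.archi_bound `|x|) => //=; rewrite /g /= in_itv/= andbT ltrNl.
  by rewrite (le_lt_trans _ xn)// -normrN ler_norm.
- by move=> _ [x ->]; exact: (esym (same_rays x)).
- move=> k; exact: (le_lt_trans (probability_le1 nu (measurable_itv _)) (ltry 1)).
Qed.
End determinacy_intervals.

Lemma moment_distribution (d : measure_display) (T : measurableType d)
    (R : realType) (P : probability T R) (X : {RV P >-> R}) (k : nat) :
  finite_moments P X ->
  moment (distribution P X) (fun x : R => x) k = moment P X k.
Proof.
move=> fX; rewrite /moment unlock integral_distribution//; last exact: fX.
by apply/measurable_EFinP; exact: exprn_measurable.
Qed.

Lemma finite_moments_distribution (d : measure_display) (T : measurableType d)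
    (R : realType) (P : probability T R) (X : {RV P >-> R}) :
  finite_moments P X -> finite_moments (distribution P X) (fun x : R => x).
Proof.
move=> fX k; apply: integrable_pushforward => //.
  by apply/measurable_EFinP; exact: exprn_measurable.
exact: fX.
Qed.

(** A competitor nu has the even moments of X, so it satisfies the same moment
    bound and integrates the same exponentials; the constant K + 1 takes care of
    the moment of order 0, which the comparison of moments leaves out. *)
Lemma cramer_M_det (d : measure_display) (T : measurableType d)
    (R : realType) (P : probability T R) (X : {RV P >-> R}) (a : R) :
  finite_moments P X -> a <= 1 -> even_moments_bigO X a -> cramer P X /\ M_det X.
Proof.
move=> fX a1 /(even_moments_bound fX a1)[K K0 mK].
have mX : measurable_fun setT X by [].
have t0 : 0 < (2 * expR 1)^-1 :> R by rewrite invr_gt0 mulr_gt0// expR_gt0.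
have eX := exp_integrable mX fX K0 mK.
split; first exact: (cramer_of_exp_integrable mX t0 eX).
move=> nu fnu mom A mA.
have fD := finite_moments_distribution fX.
have mom' k : (0 < k)%N ->
    moment nu (fun x : R => x) k = moment (distribution P X) (fun x : R => x) k.
  by move=> k0; rewrite mom// moment_distribution.
have eD : (\int[distribution P X]_x (expR ((2 * expR 1)^-1 * x) +
    expR (- ((2 * expR 1)^-1 * x)))%:E < +oo)%E.
  apply: le_lt_trans eX; rewrite ge0_integral_distribution//.
    apply/measurable_EFinP; apply: measurable_funD.
      by apply: measurableT_comp => //; exact: measurable_funM.
    by do 2 apply: measurableT_comp => //; exact: measurable_funM.
have enu : (\int[nu]_x (expR ((2 * expR 1)^-1 * x) +
    expR (- ((2 * expR 1)^-1 * x)))%:E < +oo)%E.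
  apply: (exp_integrable (K := K + 1) _ fnu); [exact: measurable_id|exact: addr_ge0|].
  case=> [|k].
    rewrite muln0 expr0 mulr1 /moment unlock.
    under eq_integral do rewrite expr0.
    rewrite integral_cst// mul1e.
    apply: (@le_trans _ _ 1%E); first exact: (probability_le1 nu measurableT).
    by rewrite lee_fin lerDr.
  rewrite mom ?muln_gt0// (le_trans (mK _))// lee_fin ler_wpM2r// ?lerDl//.
exact: (eq_of_moments fD fnu t0 eD enu mom').
Qed.

(** * Band-limited sequences *)

(** The sequences n |-> int cos(y n) d rho(y), for signed measures rho on
    [-b, b] of total variation at most C. Pointwise limits stand for the
    integrals, and induction transfers any closed linear estimate from the
    cosines to all mixtures. *)
Inductive cos_mixture {R : realType} (b : R) : R -> (nat -> R) -> Prop :=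
| mixture_cos (y : R) : `|y| <= b -> cos_mixture b 1 (fun n => cos (y * n%:R))
| mixtureZ (a C : R) (f : nat -> R) : cos_mixture b C f ->
    cos_mixture b (`|a| * C) (fun n => a * f n)
| mixtureD (C D : R) (f g : nat -> R) : cos_mixture b C f -> cos_mixture b D g ->
    cos_mixture b (C + D) (fun n => f n + g n)
| mixture_lim (C : R) (h : nat -> nat -> R) (f : nat -> R) :
    (forall m, cos_mixture b C (h m)) ->
    (forall n, (fun m => h m n) @ \oo --> f n) -> cos_mixture b C f.

Section cos_mixtures.
Context {R : realType}.
Implicit Types (b C y : R) (f g : nat -> R).

Lemma mixture_le b b' C f : b <= b' -> cos_mixture b C f -> cos_mixture b' C f.
Proof.
move=> bb'; elim=> {C f}.
- by move=> y yb; apply: mixture_cos; exact: le_trans bb'.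
- by move=> a C f _ ih; exact: mixtureZ.
- by move=> C D f g _ ihf _ ihg; exact: mixtureD.
- by move=> C h f _ ih hf; exact: mixture_lim ih hf.
Qed.

Lemma mixture_norm_le b C f : cos_mixture b C f -> forall n, `|f n| <= C.
Proof.
elim=> {C f}.
- by move=> y _ n; exact: cos_max.
- by move=> a C f _ ih n; rewrite normrM ler_wpM2l.
- by move=> C D f g _ ihf _ ihg n; rewrite (le_trans (ler_normD _ _))// lerD.
- move=> C h f _ ih hf n.
  by apply: (cvgr_to_le (cvg_norm (hf n))); apply: nearW => m; exact: ih.
Qed.

Lemma mixtureM_cos b C f y : cos_mixture b C f ->
  cos_mixture (b + `|y|) C (fun n => cos (y * n%:R) * f n).
Proof.
elim=> {C f}.
- move=> z zb.
  have half : (1 : R) = `|2^-1| * 1 + `|2^-1| * 1.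
    by rewrite mulr1 ger0_norm ?invr_ge0//; field.
  rewrite [X in cos_mixture _ X _]half.
  rewrite (_ : (fun n => _) =
      fun n => 2^-1 * cos ((z + y) * n%:R) + 2^-1 * cos ((z - y) * n%:R)).
    apply: mixtureD; apply: mixtureZ; apply: mixture_cos.
      by rewrite (le_trans (ler_normD _ _))// lerD2r.
    by rewrite (le_trans (ler_normB _ _))// lerD2r.
  by apply/funext => n; rewrite mulrDl mulrBl cosD cosB; field.
- move=> a C f _ ih; rewrite (_ : (fun n => _) =
      fun n => a * (cos (y * n%:R) * f n)); first exact: mixtureZ.
  by apply/funext => n; ring.
- move=> C D f g _ ihf _ ihg; rewrite (_ : (fun n => _) =
      fun n => cos (y * n%:R) * f n + cos (y * n%:R) * g n); first exact: mixtureD.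
  by apply/funext => n; ring.
- move=> C h f _ ih hf; apply: (mixture_lim ih) => n.
  by apply: cvgM => //; exact: cvg_cst.
Qed.

Definition sinc y : R := if y == 0 then 1 else sin y / y.

(** Viete's product: the cosines have frequencies y/2, y/4, ..., whose sum is
    at most |y| in absolute value. *)
Lemma sin_cos_prod y m :
  sin y = 2 ^+ m * sin (y / 2 ^+ m) * \prod_(0 <= j < m) cos (y / 2 ^+ j.+1).
Proof.
elim: m => [|m ih]; first by rewrite big_nil expr0 divr1 mul1r mulr1.
rewrite big_nat_recr//= {1}ih.
have -> : y / 2 ^+ m = (y / 2 ^+ m.+1) *+ 2.
  have e2 : (2 : R) ^+ m != 0 by rewrite expf_neq0.
  by rewrite -mulr_natr exprS; field.
rewrite sin_mulr2n -mulr_natr exprS; set p := \prod_(0 <= j < m) _; ring.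
Qed.

Lemma cvg_sin_div : (fun h : R => sin h / h) @ 0^' --> (1 : R).
Proof.
have := @ex_derive _ _ _ _ _ _ _ (@is_derive_sin R 0).
rewrite /derivable => /cvg_ex[l hl].
have := @derive_val _ _ _ _ _ _ _ (@is_derive_sin R 0).
rewrite /derive (cvg_lim _ hl)// cos0 => l1; move: hl; rewrite l1.
apply: cvg_trans; apply: near_eq_cvg; apply: nearW => h /=.
by rewrite sin0 subr0 addr0 /GRing.scale /= mulr1 mulrC.
Qed.

Lemma cvg_cos_prod y :
  (fun m => \prod_(0 <= j < m) cos (y / 2 ^+ j.+1)) @ \oo --> sinc y.
Proof.
rewrite /sinc; have [->|y0] := eqVneq y 0.
  rewrite (_ : (fun m => _) = cst 1); first exact: cvg_cst.
  by apply/funext => m; rewrite big1// => j _; rewrite mul0r cos0.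
have half0 : (fun m => y / 2 ^+ m) @ \oo --> (0 : R).
  rewrite -(mulr0 y); apply: cvgM; first exact: cvg_cst.
  under eq_fun do rewrite -exprVn.
  by apply: cvg_expr; rewrite ger0_norm ?invr_ge0// invf_lt1// ltr1n.
have nz m : y / 2 ^+ m != 0 by rewrite mulf_neq0// invr_neq0// expf_neq0.
have S : (fun m => sin (y / 2 ^+ m) / (y / 2 ^+ m)) @ \oo --> (1 : R).
  by move/cvgr_dnbhsP : cvg_sin_div; apply; split.
have -> : sin y / y = sin y / (y * 1) by rewrite mulr1.
apply: cvg_trans (_ : (fun m => sin y / (y * (sin (y / 2 ^+ m) / (y / 2 ^+ m)))) @ \oo --> _).
  apply: near_eq_cvg; near=> m.
  have sm : sin (y / 2 ^+ m) != 0.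
    have : 0 < sin (y / 2 ^+ m) / (y / 2 ^+ m) by near: m; exact: (cvgr_gt _ S).
    by apply: contraTneq => ->; rewrite mul0r ltxx.
  rewrite {1}(sin_cos_prod y m).
  have e2 : (2 : R) ^+ m != 0 by rewrite expf_neq0.
  set p := \prod_(0 <= j < m) _.
  by field; rewrite e2 y0 sm.
apply: cvgM; first exact: cvg_cst.
apply: cvgV; first by rewrite mulf_neq0// oner_neq0.
by apply: cvgM => //; exact: cvg_cst.
Unshelve. all: by end_near. Qed.

(** By Viete's product, multiplication by sinc spreads the band by the total
    frequency y of the cosines, and multiplication by cosines does not increase
    the mass. *)
Lemma mixtureM_sinc b C f y : cos_mixture b C f ->
  cos_mixture (b + `|y|) C (fun n => sinc (y * n%:R) * f n).
Proof.
move=> bf.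
apply: (@mixture_lim _ _ _ (fun m n =>
    (\prod_(0 <= j < m) cos (y * n%:R / 2 ^+ j.+1)) * f n)); last first.
  by move=> n; apply: cvgM; [exact: cvg_cos_prod|exact: cvg_cst].
(* the first m cosines have total frequency y (1/2 + ... + 2^-m) *)
move=> m; apply: (@mixture_le (b + `|y| * (1 - (2 ^+ m)^-1))).
  by rewrite lerD2l ler_piMr// gerBl invr_ge0 exprn_ge0.
elim: m => [|m ih].
  rewrite expr0 invr1 subrr mulr0 addr0.
  by under eq_fun do rewrite big_nil mul1r.
have -> : b + `|y| * (1 - (2 ^+ m.+1)^-1) =
    b + `|y| * (1 - (2 ^+ m)^-1) + `|y / 2 ^+ m.+1|.
  rewrite normrM (ger0_norm (_ : 0 <= (2 ^+ m.+1)^-1)) ?invr_ge0 ?exprn_ge0//.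
  have e2 : (2 : R) ^+ m != 0 by rewrite expf_neq0.
  by rewrite exprS; field.
rewrite (_ : (fun n => _) = fun n => cos (y / 2 ^+ m.+1 * n%:R) *
    ((\prod_(0 <= j < m) cos (y * n%:R / 2 ^+ j.+1)) * f n)).
  exact: mixtureM_cos.
apply/funext => n; rewrite big_nat_recr//=.
rewrite [y * n%:R / _]mulrAC; ring.
Qed.

Lemma mixtureM_sin2 b C f y : cos_mixture b C f ->
  cos_mixture (b + 2 * `|y|) C (fun n => sin (y * n%:R) ^+ 2 * f n).
Proof.
move=> bf.
have -> : C = `|2^-1| * C + `|- 2^-1| * C.
  by rewrite normrN ger0_norm ?invr_ge0//; field.
rewrite (_ : (fun n => _) =
    fun n => 2^-1 * f n + (- 2^-1) * (cos (2 * y * n%:R) * f n)).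
  apply: mixtureD; apply: mixtureZ.
    by apply: mixture_le bf; rewrite lerDl mulr_ge0.
  have -> : 2 * `|y| = `|2 * y| by rewrite normrM ger0_norm.
  exact: mixtureM_cos.
apply/funext => n; rewrite -mulrA mulr_natl cos_mulr2n sin2cos2 -mulr_natr.
by field.
Qed.

End cos_mixtures.

(** * Alternating sums of band-limited sequences *)

Section alternating_sums.
Context {R : realType}.

(** The two-sided series of (-1)^n f |n| over the integers, with the terms of
    index n and - n grouped. *)
Definition alternating_term (f : nat -> R) (n : nat) : R :=
  if n == 0%N then f 0%N else 2 * (-1) ^+ n * f n.

Definition fejer_sum (f : nat -> R) (M : nat) : R :=
  \sum_(0 <= m < M) series (alternating_term f) m.+1.

(** The closed form of the Fejer kernel at the frequency y + pi. *)
Lemma fejer_sum_cos (y : R) (M : nat) :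
  (1 + cos y) * fejer_sum (fun n => cos (y * n%:R)) M =
  1 - (-1) ^+ M * cos (y * M%:R).
Proof.
have cosS n : cos (y * n.+2%:R) + cos (y * n%:R) = 2 * cos y * cos (y * n.+1%:R).
  have -> : y * n.+2%:R = y * n.+1%:R + y by rewrite -[n.+2%:R]natr1; ring.
  have -> : y * n%:R = y * n.+1%:R - y by rewrite -natr1; ring.
  by rewrite cosD cosB; ring.
have S m : (1 + cos y) * series (alternating_term (fun n => cos (y * n%:R))) m.+1 =
    (-1) ^+ m * (cos (y * m.+1%:R) + cos (y * m%:R)).
  elim: m => [|m ih].
    rewrite /series/= big_nat1 /alternating_term/= expr0 mulr0 cos0 mulr1.
    by rewrite mulr1 mul1r addrC.
  rewrite /series/= big_nat_recr//= mulrDr -[X in _ * X + _]/(series _ _) ih.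
  rewrite /alternating_term/= exprS.
  have := cosS m => /(canRL (addrK _)) ->; ring.
elim: M => [|M ih].
  by rewrite /fejer_sum big_nil mulr0 expr0 mulr0 cos0 mulr1 subrr.
rewrite /fejer_sum big_nat_recr//= mulrDr S -[X in _ * X + _]/(fejer_sum _ _) ih.
by rewrite exprS; ring.
Qed.

Lemma alternating_termZ (a : R) (f : nat -> R) :
  alternating_term (fun n => a * f n) = fun n => a * alternating_term f n.
Proof.
by apply/funext => n; rewrite /alternating_term; case: ifP => // _; ring.
Qed.

Lemma alternating_termD (f g : nat -> R) :
  alternating_term (fun n => f n + g n) =
  fun n => alternating_term f n + alternating_term g n.
Proof.
by apply/funext => n; rewrite /alternating_term; case: ifP => // _; ring.
Qed.

(** The Fejer sums of a cosine of frequency at most pi/2 twisted by (-1)^n are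
    bounded, because the twist moves the frequency away from 0 modulo 2 pi. *)
Lemma fejer_sum_le (b C : R) (f : nat -> R) (M : nat) : b <= pi / 2 ->
  cos_mixture b C f -> `|fejer_sum f M| <= 2 * C.
Proof.
move=> b2; elim=> {C f}.
- move=> y yb.
  have cy : 0 <= cos y by apply: cos_ge0_pihalf; rewrite -ler_norml (le_trans yb).
  have y1 : 0 < 1 + cos y by rewrite ltr_pwDl.
  have -> : fejer_sum (fun n => cos (y * n%:R)) M =
      (1 - (-1) ^+ M * cos (y * M%:R)) / (1 + cos y).
    by rewrite -fejer_sum_cos mulrC mulKf// gt_eqF.
  rewrite normrM normfV (gtr0_norm y1) ler_pdivrMr//.
  rewrite (@le_trans _ _ 2)//; last by rewrite mulr1 ler_peMr// lerDl.
  rewrite (le_trans (ler_normB _ _))// normr1 normrMsign.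
  by rewrite -[leRHS]/(1 + 1) lerD2l cos_max.
- move=> a C f _ ih; rewrite /fejer_sum alternating_termZ.
  have -> : \sum_(0 <= m < M) series (fun n => a * alternating_term f n) m.+1 =
      a * fejer_sum f M.
    rewrite /fejer_sum mulr_sumr; apply: eq_bigr => m _.
    by rewrite /series/= mulr_sumr.
  by rewrite normrM mulrCA ler_wpM2l.
- move=> C D f g _ ihf _ ihg; rewrite /fejer_sum alternating_termD.
  have -> : \sum_(0 <= m < M)
      series (fun n => alternating_term f n + alternating_term g n) m.+1 =
      fejer_sum f M + fejer_sum g M.
    rewrite /fejer_sum -big_split/=; apply: eq_bigr => m _.
    by rewrite /series/= big_split.
  by rewrite mulrDr (le_trans (ler_normD _ _))// lerD.
- move=> C h f _ ih hf.
  have cv : (fun m => fejer_sum (h m) M) @ \oo --> fejer_sum f M.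
    rewrite /fejer_sum /series/=; apply: cvg_big => [|i _]; [exact: add_continuous|].
    apply: cvg_big => [|j _]; first exact: add_continuous.
    rewrite /alternating_term; case: ifP => // _.
    by apply: cvgM => //; exact: cvg_cst.
  by apply: (cvgr_to_le (cvg_norm cv)); apply: nearW => m; exact: ih.
Qed.

(** The Fejer sums divided by M are the Cesaro means of the partial sums; being
    O(1/M), they tend to 0. *)
Lemma alternating_sum_eq0 (b C l : R) (f : nat -> R) : b <= pi / 2 ->
  cos_mixture b C f -> series (alternating_term f) @ \oo --> l -> l = 0.
Proof.
move=> b2 mf fl.
have /cesaro ml : (fun m => series (alternating_term f) m.+1) @ \oo --> l.
  by rewrite -(@cvg_shiftS _ (series (alternating_term f))) in fl.
suff m0 : arithmetic_mean (fun m => series (alternating_term f) m.+1) @ \oo --> (0 : R).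
  exact: (cvg_unique _ ml m0).
apply/norm_cvg0P; apply: (@squeeze_cvgr _ _ _ _ (cst 0) (fun n => 2 * C * n.+1%:R^-1)).
- apply: nearW => n; rewrite normr_ge0/= normrM [leRHS]mulrC normfV.
  by rewrite normr_nat ler_wpM2l// (fejer_sum_le _ b2 mf).
- exact: cvg_cst.
- by rewrite -(mulr0 (2 * C)); apply: cvgM; [exact: cvg_cst|exact: cvg_harmonic].
Qed.

End alternating_sums.

(** * Products of squared cardinal sines *)

Lemma sinc0 {R : realType} : sinc (0 : R) = 1.
Proof. by rewrite /sinc eqxx. Qed.

Lemma sqr_sinc_le1 {R : realType} (y : R) : sinc y ^+ 2 <= 1.
Proof.
have one : `|0 : R| <= 0 by rewrite normr0.
have := mixture_norm_le (mixtureM_sinc y (mixture_cos one)) 1.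
by rewrite mul0r cos0 mulr1 mulr1 => h; rewrite -real_normK ?num_real// exprn_ile1.
Qed.

Section weight.
Context {R : realType} (c : R^nat).
Hypothesis c_gt0 : forall j, 0 < c j.

Definition partial_weight (m n : nat) : R :=
  \prod_(0 <= j < m) sinc (c j * n%:R) ^+ 2.

Definition weight (n : nat) : R := limn (fun m => partial_weight m n).

Lemma partial_weight_ge0 m n : 0 <= partial_weight m n.
Proof. by apply: prodr_ge0 => j _; exact: sqr_ge0. Qed.

Lemma cvg_partial_weight n : (fun m => partial_weight m n) @ \oo --> weight n.
Proof.
apply: nonincreasing_is_cvgn; last first.
  by exists 0 => _ [m _ <-]; exact: partial_weight_ge0.
apply/nonincreasing_seqP => m; rewrite /partial_weight big_nat_recr//=.
by rewrite ler_piMr ?sqr_sinc_le1//; exact: partial_weight_ge0.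
Qed.

Lemma weight_ge0 n : 0 <= weight n.
Proof.
apply: (cvgr_to_ge (@cvg_partial_weight n)); apply: nearW => m.
exact: partial_weight_ge0.
Qed.

Lemma weight0 : weight 0 = 1.
Proof.
apply/cvg_lim => //; rewrite (_ : (fun m => _) = cst 1); first exact: cvg_cst.
apply/funext => m; rewrite /partial_weight big1// => j _.
by rewrite mulr0 sinc0 expr1n.
Qed.

(** Each of the first k factors sinc^2 is traded for n^2 sinc^2 = sin^2 / c^2,
    which is a cosine mixture of the same band. *)
Lemma mixture_partial_weight (k m : nat) :
  cos_mixture (\sum_(0 <= j < m + k) 2 * c j) (\prod_(0 <= j < k) (c j) ^- 2)
    (fun n => n%:R ^+ (2 * k) * partial_weight (m + k) n).
Proof.
have cn j : `|c j| = c j by rewrite gtr0_norm.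
have sum_recr M : \sum_(0 <= j < M.+1) 2 * c j =
    \sum_(0 <= j < M) 2 * c j + 2 * `|c M| by rewrite big_nat_recr//= cn.
elim: m => [|m ih].
  rewrite add0n; elim: k => [|k ih].
    rewrite !big_nil (_ : (fun n => _) = fun n => cos (0 * n%:R)).
      by apply: mixture_cos; rewrite normr0.
    by apply/funext => n; rewrite /partial_weight big_nil mul0r cos0 muln0 mulr1.
  rewrite sum_recr [\prod_(0 <= j < k.+1) _]big_nat_recr//=.
  rewrite [X in cos_mixture _ X _]mulrC.
  rewrite -[X in cos_mixture _ (X * _) _]gtr0_norm ?invr_gt0 ?exprn_gt0//.
  rewrite (_ : (fun n => _) = fun n => (c k) ^- 2 * (sin (c k * n%:R) ^+ 2 *
      (n%:R ^+ (2 * k) * partial_weight k n))).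
    by apply: mixtureZ; exact: mixtureM_sin2.
  apply/funext => n; rewrite /partial_weight big_nat_recr//= mulnS exprD.
  have ck : c k != 0 by rewrite gt_eqF.
  rewrite /sinc; case: n => [|n]; first by rewrite !mulr0 sin0 expr0n/= !mul0r mulr0.
  have n0 : n.+1%:R != 0 :> R by rewrite pnatr_eq0.
  rewrite mulf_eq0 (negbTE ck) (negbTE n0)/=.
  by field; rewrite ck addrC natr1 n0.
rewrite addSn sum_recr mulr2n mulrDl mul1r addrA.
rewrite (_ : (fun n => _) = fun n => sinc (c (m + k)%N * n%:R) *
   (sinc (c (m + k)%N * n%:R) * (n%:R ^+ (2 * k) * partial_weight (m + k) n))).
  by do 2 apply: mixtureM_sinc.
by apply/funext => n; rewrite /partial_weight big_nat_recr//=; ring.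
Qed.

Lemma mixture_weight (b : R) (k : nat) :
  (forall m, \sum_(0 <= j < m) 2 * c j <= b) ->
  cos_mixture b (\prod_(0 <= j < k) (c j) ^- 2)
    (fun n => n%:R ^+ (2 * k) * weight n).
Proof.
move=> cb; apply: (mixture_lim (h := fun m n => n%:R ^+ (2 * k) * partial_weight (m + k) n)).
  by move=> m; apply: mixture_le (mixture_partial_weight k m).
move=> n; apply: cvgM; first exact: cvg_cst.
rewrite (@cvg_shiftn k _ (fun m => partial_weight m n)); exact: cvg_partial_weight.
Qed.

(** The masses weight |n| on the integers, folded onto the nonnegative
    integers; the value at 0 is weight 0 = 1. *)
Definition folded_weight (n : nat) : R := if n == 0%N then 1 else 2 * weight n.

Lemma folded_weight_ge0 n : 0 <= folded_weight n.
Proof. by rewrite /folded_weight; case: ifP => // _; rewrite mulr_ge0// weight_ge0. Qed.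

Hypothesis c_le1 : forall j, c j <= 1.

(** Adding the mixture bounds for k and k + 1 gives a decay in 1 / (1 + n^2),
    which is compared with the telescoping series of 1 / ((n + 1)(n + 2)). *)
Lemma folded_weight_sum_le (b : R) (k N : nat) :
  (forall m, \sum_(0 <= j < m) 2 * c j <= b) ->
  series (fun n => folded_weight n * n%:R ^+ (2 * k)) N <=
    16 * \prod_(0 <= j < k.+1) (c j) ^- 2.
Proof.
move=> cb; set D := \prod_(0 <= j < k.+1) _.
have c1 j : 1 <= (c j) ^- 2.
  by rewrite -exprVn exprn_ege1// invf_ge1.
have D_ge0 i : 0 <= \prod_(0 <= j < i) (c j) ^- 2.
  by apply: prodr_ge0 => j _; rewrite invr_ge0 sqr_ge0.
have Dk : \prod_(0 <= j < k) (c j) ^- 2 <= D.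
  by rewrite /D big_nat_recr//= ler_peMr.
have bnd i n : n%:R ^+ (2 * i) * weight n <= \prod_(0 <= j < i) (c j) ^- 2.
  exact: le_trans (ler_norm _) (mixture_norm_le (mixture_weight i cb) n).
have term n : folded_weight n * n%:R ^+ (2 * k) <=
    16 * D * (n.+1%:R^-1 - n.+2%:R^-1).
  have q2 : folded_weight n <= 2 * weight n.
    rewrite /folded_weight; case: eqP => // ->.
    by rewrite weight0 mulr1 ler1n.
  have n1 : (0 : R) < n.+1%:R * n.+2%:R by rewrite mulr_gt0.
  have -> : n.+1%:R^-1 - n.+2%:R^-1 = (n.+1%:R * n.+2%:R)^-1 :> R.
    rewrite -[n.+2%:R]natr1; field.
    by rewrite (addrC 1) !natr1 !pnatr_eq0.
  rewrite ler_pdivlMr//.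
  have N4 : n.+1%:R * n.+2%:R <= 4 * (1 + n%:R ^+ 2) :> R.
    rewrite -[n.+2%:R]natr1 -[n.+1%:R]natr1.
    by have := sqr_ge0 (n%:R - 2^-1 : R); nra.
  have e : n%:R ^+ (2 * k) * weight n * (1 + n%:R ^+ 2) <= D + D.
    have -> : n%:R ^+ (2 * k) * weight n * (1 + n%:R ^+ 2) =
       n%:R ^+ (2 * k) * weight n + n%:R ^+ (2 * k.+1) * weight n.
      by rewrite mulnS exprD; ring.
    by rewrite lerD// (le_trans (bnd k n)).
  have w0 : 0 <= n%:R ^+ (2 * k) * weight n.
    by rewrite mulr_ge0 ?exprn_ge0 ?weight_ge0.
  apply: (@le_trans _ _ (2 * (n%:R ^+ (2 * k) * weight n) * (4 * (1 + n%:R ^+ 2)))).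
    rewrite ler_pM ?(ltW n1) ?mulr_ge0 ?folded_weight_ge0 ?exprn_ge0//.
    by rewrite [X in X <= _]mulrC mulrCA ler_wpM2l ?exprn_ge0.
  have -> : 2 * (n%:R ^+ (2 * k) * weight n) * (4 * (1 + n%:R ^+ 2)) =
    8 * (n%:R ^+ (2 * k) * weight n * (1 + n%:R ^+ 2)) by ring.
  have -> : 16 * D = 8 * (D + D) by ring.
  by rewrite ler_wpM2l.
rewrite /series/=; apply: (le_trans (ler_sum _ (fun i _ => term i))).
rewrite -mulr_sumr ler_piMr ?mulr_ge0 ?D_ge0//.
have -> : \sum_(0 <= i < N) (i.+1%:R^-1 - i.+2%:R^-1) = 1 - N.+1%:R^-1 :> R.
  elim: N => [|N ih]; first by rewrite big_nil invr1 subrr.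
  by rewrite big_nat_recr//= ih; ring.
by rewrite gerBl invr_ge0.
Qed.

Lemma cvg_folded_weight (b : R) (k : nat) :
  (forall m, \sum_(0 <= j < m) 2 * c j <= b) ->
  cvgn (series (fun n => folded_weight n * n%:R ^+ (2 * k))).
Proof.
move=> cb; apply: nondecreasing_is_cvgn; last first.
  by eexists => _ [N _ <-]; exact: folded_weight_sum_le cb.
apply/nondecreasing_seqP => N; rewrite /series/= big_nat_recr//= lerDl.
by rewrite mulr_ge0 ?folded_weight_ge0 ?exprn_ge0.
Qed.

Lemma alternating_weight_sum (b : R) (k : nat) : b <= pi / 2 ->
  (forall m, \sum_(0 <= j < m) 2 * c j <= b) ->
  series (fun n => (-1) ^+ n * (folded_weight n * n%:R ^+ (2 * k))) @ \oo --> (0 : R).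
Proof.
move=> b2 cb.
have E : (fun n => (-1) ^+ n * (folded_weight n * n%:R ^+ (2 * k))) =
    alternating_term (fun n => n%:R ^+ (2 * k) * weight n).
  apply/funext => n; rewrite /alternating_term /folded_weight.
  by case: eqP => [->|_]; [rewrite expr0 weight0 mulr1 !mul1r|ring].
have cv : cvgn (series (fun n => (-1) ^+ n * (folded_weight n * n%:R ^+ (2 * k)))).
  apply: normed_cvg; rewrite (_ : [normed _] =
      series (fun n => folded_weight n * n%:R ^+ (2 * k))).
    exact: cvg_folded_weight cb.
  congr series; apply/funext => n; rewrite /= normrMsign ger0_norm//.
  by rewrite mulr_ge0 ?folded_weight_ge0 ?exprn_ge0.
move: (cv); rewrite E => cvE.
have l0 := alternating_sum_eq0 b2 (mixture_weight k cb) cvE.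
by move: cvE; rewrite l0.
Qed.

End weight.

(** * Symmetric laws on the integers *)

Section symmetric_law.
Context {R : realType}.

(** Mass p n is split evenly between n and - n. The proof that p has sum 1 is an
    argument so that the probability structure can be attached to the term. *)
Definition symmetric_law (p : R^nat) (p_ge0 : forall n, 0 <= p n)
    (p_sum : (\sum_(n <oo) (p n)%:E = 1)%E) : set R -> \bar R :=
  mseries (fun n => measure_add
    (mscale (NngNum (divr_ge0 (p_ge0 n) (ler0n R 2))) \d_(n%:R : R))
    (mscale (NngNum (divr_ge0 (p_ge0 n) (ler0n R 2))) \d_(- n%:R : R))) 0.

Section properties.
Variables (p : R^nat) (p_ge0 : forall n, 0 <= p n)
  (p_sum : (\sum_(n <oo) (p n)%:E = 1)%E).
Local Notation law := (symmetric_law p_ge0 p_sum).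

HB.instance Definition _ := Measure.on law.

Lemma ge0_integral_symmetric_law (f : R -> \bar R) :
  (forall x, 0 <= f x)%E -> measurable_fun setT f ->
  (\int[law]_x f x = \sum_(n <oo) (p n / 2)%:E * (f (n%:R)%R + f (- n%:R)%R))%E.
Proof.
move=> f0 mf; rewrite ge0_integral_measure_series//.
apply: eq_eseriesr => n _.
rewrite ge0_integral_measure_add//.
rewrite !ge0_integral_mscale// !integral_dirac//= !diracT !mul1e.
by rewrite ge0_muleDr.
Qed.

Lemma symmetric_law_setT : law setT = 1%E.
Proof.
have := @ge0_integral_symmetric_law (cst 1%E) (fun=> lee01) (@measurable_cst _ _ _ _ _ _).
rewrite integral_cst// mul1e => ->; rewrite -p_sum; apply: eq_eseriesr => n _.
by rewrite /= p_sum -(EFinD 1 1) -EFinM mulrDr mulr1 -splitr.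
Qed.

HB.instance Definition _ := Measure_isProbability.Build _ _ _ law symmetric_law_setT.

Lemma ge0_moment_series (k : nat) :
  (\int[law]_x (x ^+ (2 * k))%:E = \sum_(n <oo) (p n * n%:R ^+ (2 * k))%:E)%E.
Proof.
rewrite ge0_integral_symmetric_law.
- apply: eq_eseriesr => n _; rewrite -EFinD -EFinM; congr EFin.
  by rewrite !exprM sqrrN -exprM; field.
- by move=> x; rewrite lee_fin exprM exprn_ge0// sqr_ge0.
- by apply/measurable_EFinP; exact: exprn_measurable.
Qed.

Hypothesis p_moments : forall k, cvgn (series (fun n => p n * n%:R ^+ (2 * k))).

Lemma even_moment_law (k : nat) : moment law (fun x : R => x) (2 * k) =
  (limn (series (fun n => p n * n%:R ^+ (2 * k))))%:E.
Proof. by rewrite /moment unlock ge0_moment_series eseries_EFin. Qed.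

Lemma finite_moments_law : finite_moments law (fun x : R => x).
Proof.
have even k : law.-integrable setT (fun x : R => (x ^+ (2 * k))%:E).
  apply/integrableP; split; first by apply/measurable_EFinP; exact: exprn_measurable.
  rewrite (eq_integral (fun x : R => (x ^+ (2 * k))%:E)).
    by rewrite ge0_moment_series eseries_EFin// ltry.
  by move=> x _ /=; rewrite ger0_norm// exprM exprn_ge0// sqr_ge0.
move=> k.
have i1 := integrableD measurableT (even 0%N) (even k).
apply: le_integrable i1 => //; first by apply/measurable_EFinP; exact: exprn_measurable.
move=> x _.
rewrite -EFinD /= lee_fin muln0 expr0.
have xk : x ^+ (2 * k) = `|x ^+ k| ^+ 2 by rewrite real_normK ?num_real// -exprM mulnC.
rewrite xk [leRHS]ger0_norm ?addr_ge0 ?sqr_ge0//.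
by have := sqr_ge0 (`|x ^+ k| - 1); nra.
Qed.

(** An odd power has the same positive as negative part up to reflection. *)
Lemma odd_moment_law (k : nat) : odd k -> moment law (fun x : R => x) k = 0%E.
Proof.
move=> ok; rewrite /moment unlock integralE.
have mk : measurable_fun setT (fun x : R => (x ^+ k)%:E).
  by apply/measurable_EFinP; exact: exprn_measurable.
set f := (fun x : R => (x ^+ k)%:E) in mk *.
have fN x : f (- x) = (- f x)%E.
  by rewrite /f exprNn -signr_odd ok expr1 mulN1r.
have posneg : (\int[law]_x f^\- x = \int[law]_x f^\+ x)%E.
  rewrite !ge0_integral_symmetric_law//; first last.
  - exact: measurable_funeneg.
  - exact: measurable_funepos.
  apply: eq_eseriesr => n _; congr (_ * _)%E.
  by rewrite !funenegE !funeposE !fN oppeK addeC.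
rewrite posneg subee//.
have /integrable_funepos := finite_moments_law k; move/(_ measurableT) => ip.
exact: integrable_fin_num ip.
Qed.

Lemma symmetric_lawE (A : set R) : measurable A ->
  law A = (\sum_(n <oo) (p n / 2 * (\1_A n%:R + \1_A (- n%:R)))%:E)%E.
Proof.
move=> mA; have := @ge0_integral_symmetric_law (fun x => (\1_A x)%:E).
rewrite integral_indic// setIT => ->.
- by apply: eq_eseriesr => n _; rewrite -EFinD -EFinM.
- by move=> x; rewrite lee_fin.
- by apply/measurable_EFinP; exact: measurable_indic.
Qed.

Lemma symmetric_law_ge (A : set R) (n : nat) : measurable A -> A n%:R ->
  ((p n / 2)%:E <= law A)%E.
Proof.
move=> mA An; rewrite symmetric_lawE// (@nneseriesD1 _ _ n)//; last first.
  by move=> i _; rewrite lee_fin mulr_ge0 ?addr_ge0// divr_ge0.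
rewrite (@le_trans _ _ (p n / 2 * (\1_A n%:R + \1_A (- n%:R)))%:E)//.
  by rewrite lee_fin ler_peMr ?divr_ge0// indicE mem_set// lerDl.
rewrite leeDl// nneseries_ge0// => i _ _.
by rewrite lee_fin mulr_ge0 ?addr_ge0// divr_ge0.
Qed.

Lemma symmetric_law_set0 : law [set 0] = (p 0)%:E.
Proof.
rewrite symmetric_lawE//.
rewrite (@nneseriesD1 _ _ 0)//; last first.
  by move=> i _; rewrite lee_fin mulr_ge0 ?addr_ge0// divr_ge0.
rewrite eseries0 ?adde0.
  by rewrite oppr0 !indicE mem_set//=; congr EFin; field.
move=> [|i] // _ _; rewrite !indicE !memNset ?addr0 ?mulr0//.
  by move=> /= /eqP; rewrite oppr_eq0 pnatr_eq0.
by move=> /= /eqP; rewrite pnatr_eq0.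
Qed.

End properties.
End symmetric_law.

(** * Logarithmic scales *)

Section logarithmic_scales.
Context {R : realType}.

(** Differences of 1 / ln, of the order of 1 / (j (ln j)^2): they telescope to
    the sum 1/2, and yet dominate j^(-1-e) for every e > 0. *)
Definition log_scale (j : nat) : R :=
  ln 2 / 2 * ((ln j.+2%:R)^-1 - (ln j.+3%:R)^-1).

Let ln_nat_gt0 (j : nat) : 0 < ln (j.+2%:R : R).
Proof. by rewrite ln_gt0// ltr1n. Qed.

Lemma log_scale_gt0 j : 0 < log_scale j.
Proof.
rewrite mulr_gt0 ?divr_gt0 ?(ln_nat_gt0 0)// subr_gt0 ltf_pV2 ?posrE ?ln_nat_gt0//.
by rewrite ltr_ln ?posrE// ltr_nat.
Qed.

Lemma log_scale_sum (m : nat) : \sum_(0 <= j < m) 2 * log_scale j <= 1.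
Proof.
have -> : \sum_(0 <= j < m) 2 * log_scale j = 1 - ln 2 / ln m.+2%:R.
  elim: m => [|m ih]; first by rewrite big_nil divff ?subrr// gt_eqF// (ln_nat_gt0 0).
  by rewrite big_nat_recr//= ih /log_scale; field; rewrite !gt_eqF.
by rewrite gerBl divr_ge0// ltW// (ln_nat_gt0 0).
Qed.

Lemma log_scale_le1 j : log_scale j <= 1.
Proof.
have c0 := log_scale_gt0 j; apply: le_trans (log_scale_sum j.+1).
rewrite big_nat_recr//= (@le_trans _ _ (2 * log_scale j))//.
  by rewrite ler_peMl ?ler1n// ltW.
by rewrite lerDr sumr_ge0// => i _; rewrite mulr_ge0// ltW// log_scale_gt0.
Qed.

Lemma ln_le_powR (e x : R) : 0 < e -> 0 < x -> ln x <= x `^ e / e.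
Proof.
move=> e0 x0; rewrite ler_pdivlMr// mulrC -ln_powR.
by rewrite ltW// ln_sublinear// powR_gt0.
Qed.

(** With B = j + 3, the difference of logarithms is at least 1/B, and each
    logarithm is at most B^e / e. *)
Lemma log_scale_inv_le (e : R) : 0 < e ->
  exists2 K : R, 0 < K & forall j, (log_scale j)^-1 <= K * j.+3%:R `^ (1 + 2 * e).
Proof.
move=> e0; have l2 := ln_nat_gt0 0.
exists (2 / ln 2 / e ^+ 2); first by rewrite !divr_gt0// exprn_gt0.
move=> j; set B : R := j.+3%:R; set A : R := j.+2%:R.
have B0 : 0 < B by rewrite ltr0n.
have A0 : 0 < A by rewrite ltr0n.
have lA := ln_nat_gt0 j; have lB := ln_nat_gt0 j.+1; rewrite -/A -/B in lA lB.
have lAB : ln A <= ln B by rewrite ler_ln ?posrE// ler_nat.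
have gap : B^-1 <= ln B - ln A.
  have AB0 : 0 < A / B by rewrite divr_gt0.
  have AB1 : 1 + (A / B - 1) = A / B by ring.
  have AB2 : -1 < A / B - 1 by rewrite ltrDr.
  have := le_ln1Dx AB2; rewrite AB1 ln_div ?posrE// => h.
  have AB : A / B = 1 - B^-1.
    have -> : A = B - 1 by rewrite /B -natr1 addrK.
    by field; rewrite gt_eqF.
  by move: h; rewrite AB addrAC subrr add0r lerNr opprB.
have gap0 : 0 < ln B - ln A by rewrite (lt_le_trans _ gap)// invr_gt0.
have -> : (log_scale j)^-1 = 2 / ln 2 * (ln A * ln B * (ln B - ln A)^-1).
  rewrite /log_scale -/A -/B; field.
  by rewrite !gt_eqF.
rewrite -[leRHS]mulrA ler_wpM2l ?divr_ge0 ?(ltW l2)//.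
have gapi : (ln B - ln A)^-1 <= B by rewrite invf_ple ?posrE.
have lne := ln_le_powR e0 B0.
apply: (@le_trans _ _ (B `^ e / e * (B `^ e / e) * B)).
  rewrite ler_pM ?mulr_ge0 ?invr_ge0 ?(ltW lA) ?(ltW lB) ?(ltW gap0)//.
  rewrite ler_pM ?(ltW lA) ?(ltW lB)//.
  exact: le_trans lne.
have -> : 1 + 2 * e = e + e + 1 by ring.
have Bn0 r : r ==> (B != 0) by rewrite gt_eqF// implybT.
rewrite (powRD (Bn0 _)) (powRD (Bn0 _)) powRr1 ?(ltW B0)//.
by rewrite le_eqVlt; apply/orP; left; apply/eqP; field; rewrite gt_eqF.
Qed.

(** The 2(k + 1) factors are at most K (k + 3)^(1 + 2e), hence at most (2k)^s
    with s = 1 + 3e once (2k)^e exceeds K. For e = (a - 1)/6 the exponent s is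
    the midpoint of 1 and a, and the gap a - s pays for the two extra factors. *)
Lemma prod_log_scale_bigO (a : R) : 1 < a -> exists N : nat, forall k, (N <= k)%N ->
  \prod_(0 <= j < k.+1) (log_scale j) ^- 2 <= (2 * k)%N%:R `^ (2 * a * k%:R).
Proof.
move=> a1; pose e := (a - 1) / 6; have e0 : 0 < e by rewrite divr_gt0// subr_gt0.
have [K K0 cK] := log_scale_inv_le e0.
pose s := (1 + a) / 2; have s0 : 0 < s by rewrite divr_gt0//; lra.
have as0 : 0 < a - s by rewrite /s; lra.
pose N1 := Num.Def.archi_bound (K `^ e^-1).
pose N2 := Num.Def.archi_bound (s / (a - s)).
exists (3 + N1 + N2)%N => k Nk.
have k3 : (3 <= k)%N by lia.
pose y : R := (2 * k)%N%:R.
have y1 : 1 <= y by rewrite ler1n muln_gt0 (leq_trans _ k3).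
have y0 : 0 < y by rewrite (lt_le_trans _ y1).
have Ky : K <= y `^ e.
  have -> : K = (K `^ e^-1) `^ e by rewrite -powRrM mulVf ?gt_eqF// powRr1// ltW.
  apply: ge0_ler_powR; rewrite ?nnegrE ?powR_ge0 ?(ltW e0) ?(ltW y0)//.
  apply: (le_trans (ltW (archi_boundP (powR_ge0 K e^-1)))).
  by rewrite -/N1 /y ler_nat; lia.
have ks : s / (a - s) <= k%:R.
  apply: (le_trans (ltW (archi_boundP (divr_ge0 (ltW s0) (ltW as0))))).
  by rewrite -/N2 ler_nat; lia.
have fac j : (j < k.+1)%N -> (log_scale j) ^- 2 <= (y `^ s) ^+ 2.
  move=> jk; have c0 := log_scale_gt0 j.
  rewrite -exprVn lerXn2r ?nnegrE ?invr_ge0 ?powR_ge0 ?(ltW c0)//.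
  rewrite (le_trans (cK j))//.
  have -> : s = e + (1 + 2 * e) by rewrite /s /e; field.
  rewrite [leRHS]powRD; last by apply/implyP => _; rewrite gt_eqF.
  rewrite ler_pM ?powR_ge0 ?(ltW K0)//.
  apply: ge0_ler_powR; rewrite ?nnegrE ?(ltW y0)//.
    by rewrite addr_ge0// mulr_ge0// ltW.
  by rewrite /y ler_nat; lia.
apply: (@le_trans _ _ (\prod_(0 <= j < k.+1) (y `^ s) ^+ 2)).
  rewrite !big_mkord; apply: ler_prod => j _.
  by rewrite invr_ge0 sqr_ge0/= fac.
rewrite big_const_nat subn0 iter_mulr_1 -exprM -powR_mulrn ?powR_ge0// -powRrM.
rewrite -/y ler_powR//.
move: ks; rewrite ler_pdivrMr// => ks.
rewrite natrM -[k.+1%:R]natr1.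
have -> : 2 * a * k%:R = s * (2 * k%:R) + 2 * (k%:R * (a - s)) by ring.
have -> : s * (2 * (k%:R + 1)) = s * (2 * k%:R) + 2 * s by ring.
by rewrite lerD2l ler_wpM2l.
Qed.

End logarithmic_scales.

(** * An indeterminate law at the boundary *)

Section boundary_law.
Context {R : realType}.

Definition log_weight : R^nat := folded_weight log_scale.

Lemma cvg_log_weight (k : nat) :
  cvgn (series (fun n => log_weight n * n%:R ^+ (2 * k))).
Proof. exact: (cvg_folded_weight log_scale_gt0 log_scale_le1 log_scale_sum). Qed.

Lemma log_weight_ge0 n : 0 <= log_weight n.
Proof. exact: folded_weight_ge0. Qed.

Lemma log_weightE : log_weight = fun n => log_weight n * n%:R ^+ (2 * 0).
Proof. by apply/funext => n; rewrite muln0 expr0 mulr1. Qed.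

Definition log_mass : R := limn (series log_weight).

Lemma log_mass_ge1 : 1 <= log_mass.
Proof.
have cq : cvgn (series log_weight) by rewrite log_weightE; exact: cvg_log_weight.
apply: (cvgr_to_ge cq); near=> n.
have n0 : (0 < n)%N by near: n; exists 1%N.
rewrite /series/= -(prednK n0) big_nat_recl//= lerDl sumr_ge0// => i _.
exact: log_weight_ge0.
Unshelve. all: by end_near. Qed.

Let log_mass_gt0 : 0 < log_mass.
Proof. exact: lt_le_trans log_mass_ge1. Qed.

Definition log_pmf (n : nat) : R := log_weight n / log_mass.

(** The perturbation by the sign (-1)^n, which no even moment detects; it
    doubles the masses of the even integers and removes those of the odd ones. *)
Definition log_pmf_twisted (n : nat) : R := (1 + (-1) ^+ n) * log_pmf n.

Lemma log_pmf_ge0 n : 0 <= log_pmf n.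
Proof. by rewrite divr_ge0 ?log_weight_ge0// ltW. Qed.

Lemma log_pmf_twisted_ge0 n : 0 <= log_pmf_twisted n.
Proof.
rewrite mulr_ge0 ?log_pmf_ge0// -signr_odd.
by case: (odd n); rewrite /= ?expr0 ?expr1 ?subrr// addr_ge0.
Qed.

Lemma cvg_log_pmf k : series (fun n => log_pmf n * n%:R ^+ (2 * k)) @ \oo -->
  limn (series (fun n => log_weight n * n%:R ^+ (2 * k))) / log_mass.
Proof.
have -> : series (fun n => log_pmf n * n%:R ^+ (2 * k)) =
    fun N => series (fun n => log_weight n * n%:R ^+ (2 * k)) N * log_mass^-1.
  apply/funext => N; rewrite /series/= mulr_suml; apply: eq_bigr => n _.
  by rewrite /log_pmf mulrAC.
by apply: cvgM; [exact: cvg_log_weight|exact: cvg_cst].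
Qed.

Lemma cvg_log_pmf_twisted k :
  series (fun n => log_pmf_twisted n * n%:R ^+ (2 * k)) @ \oo -->
  limn (series (fun n => log_weight n * n%:R ^+ (2 * k))) / log_mass.
Proof.
have -> : series (fun n => log_pmf_twisted n * n%:R ^+ (2 * k)) =
    fun N => series (fun n => log_pmf n * n%:R ^+ (2 * k)) N +
      series (fun n => (-1) ^+ n * (log_weight n * n%:R ^+ (2 * k))) N * log_mass^-1.
  apply/funext => N; rewrite /series/= mulr_suml -big_split/=; apply: eq_bigr => n _.
  by rewrite /log_pmf_twisted /log_pmf; ring.
rewrite -[X in _ --> X]addr0; apply: cvgD; first exact: cvg_log_pmf.
rewrite -(mul0r log_mass^-1); apply: cvgM; last exact: cvg_cst.
exact: (alternating_weight_sum log_scale_gt0 log_scale_le1 k (pihalf_ge1 R) log_scale_sum).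
Qed.

Let sum1 (p : R^nat) :
  (forall k, series (fun n => p n * n%:R ^+ (2 * k)) @ \oo -->
    limn (series (fun n => log_weight n * n%:R ^+ (2 * k))) / log_mass) ->
  (\sum_(n <oo) (p n)%:E = 1)%E.
Proof.
move=> /(_ 0%N); rewrite -log_weightE divff ?gt_eqF//.
under eq_fun do rewrite muln0 expr0 mulr1.
move=> cp; rewrite eseries_EFin; first by rewrite (cvg_lim _ cp).
by apply/cvg_ex; exists 1.
Qed.

Local Notation log_law := (symmetric_law log_pmf_ge0 (sum1 cvg_log_pmf)).
Local Notation log_law_twisted :=
  (symmetric_law log_pmf_twisted_ge0 (sum1 cvg_log_pmf_twisted)).

Let cvg_moments k : cvgn (series (fun n => log_pmf n * n%:R ^+ (2 * k))).
Proof. by apply/cvg_ex; eexists; exact: cvg_log_pmf. Qed.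

Let cvg_moments_twisted k :
  cvgn (series (fun n => log_pmf_twisted n * n%:R ^+ (2 * k))).
Proof. by apply/cvg_ex; eexists; exact: cvg_log_pmf_twisted. Qed.

Lemma log_law_finite_moments : finite_moments log_law (fun x : R => x).
Proof. exact: finite_moments_law cvg_moments. Qed.

Lemma log_law_twisted_finite_moments :
  finite_moments log_law_twisted (fun x : R => x).
Proof. exact: finite_moments_law cvg_moments_twisted. Qed.

Lemma log_law_same_moments (k : nat) :
  moment log_law_twisted (fun x : R => x) k = moment log_law (fun x : R => x) k.
Proof.
have [ok|ek] := boolP (odd k).
  by rewrite (odd_moment_law log_pmf_ge0 _ cvg_moments ok)// (odd_moment_law log_pmf_twisted_ge0 _ cvg_moments_twisted ok).
have -> : k = (2 * k./2)%N.
  by rewrite -[LHS]odd_double_half (negbTE ek) add0n mul2n.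
rewrite (even_moment_law log_pmf_ge0 _ cvg_moments) (even_moment_law log_pmf_twisted_ge0 _ cvg_moments_twisted).
congr EFin; rewrite (cvg_lim _ (@cvg_log_pmf _))//.
exact: (cvg_lim _ (@cvg_log_pmf_twisted _)).
Qed.

Lemma log_law_neq : log_law_twisted [set 0] <> log_law [set 0].
Proof.
rewrite !symmetric_law_set0 => -[].
rewrite /log_pmf_twisted expr0 => /eqP; rewrite mulrDl mul1r -subr_eq0 addrK.
by rewrite mulf_eq0 invr_eq0 (gt_eqF log_mass_gt0) orbF /log_weight /folded_weight/= oner_eq0.
Qed.

Lemma log_law_moment_le (k : nat) :
  0 <= fine (moment log_law (fun x : R => x) (2 * k)) <=
    16 * \prod_(0 <= j < k.+1) (log_scale j) ^- 2.
Proof.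
rewrite (even_moment_law log_pmf_ge0 _ cvg_moments)/=.
rewrite (cvg_lim _ (@cvg_log_pmf _))//; apply/andP; split.
  rewrite divr_ge0 ?(ltW log_mass_gt0)//.
  apply: (cvgr_to_ge (@cvg_log_weight k)); apply: nearW => N.
  rewrite /series/= sumr_ge0// => n _; rewrite mulr_ge0 ?exprn_ge0//.
  exact: log_weight_ge0.
have lim_le : limn (series (fun n => log_weight n * n%:R ^+ (2 * k))) <=
    16 * \prod_(0 <= j < k.+1) (log_scale j) ^- 2.
  apply: (cvgr_to_le (@cvg_log_weight k)); apply: nearW => N.
  exact: (folded_weight_sum_le log_scale_gt0 log_scale_le1 k N log_scale_sum).
rewrite ler_pdivrMr// (le_trans lim_le)// ler_peMr ?log_mass_ge1//.
by rewrite mulr_ge0// prodr_ge0// => j _; rewrite invr_ge0 sqr_ge0.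
Qed.

Lemma log_law_bigO (X : {RV log_law >-> R}) (a : R) : X =1 (fun x : R => x) ->
  1 < a -> even_moments_bigO X a.
Proof.
move=> XE a1; have [N ND] := prod_log_scale_bigO a1.
have EX k : moment log_law X k = moment log_law (fun x : R => x) k.
  by rewrite (_ : (X : R -> R) = fun x => x)//; exact/funext.
apply/eqO_exP; exists 16 => //; exists N => // k Nk /=.
rewrite EX; have /andP[m0 mle] := log_law_moment_le k.
rewrite ger0_norm// ger0_norm ?powR_ge0// (le_trans mle)// ler_wpM2l//.
exact: ND.
Qed.

(** Were the support bounded, the moments would grow at most geometrically and
    Cramer's condition would force determinacy. *)
Lemma log_law_unbounded (X : {RV log_law >-> R}) : X =1 (fun x : R => x) ->
  M_indet X -> ~ bounded_set (supp (distribution log_law X)).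
Proof.
move=> XE indet [M [_ bM]]; apply: indet.
have XE' : (X : R -> R) = fun x => x by exact/funext.
have EX k : moment log_law X k = moment log_law (fun x : R => x) k by rewrite XE'.
have fX : finite_moments log_law X by rewrite XE'; exact: log_law_finite_moments.
have [B [MB B1]] : exists B : nat, M < B%:R /\ (0 < B)%N.
  exists (Num.Def.archi_bound `|M|).+1; split => //.
  rewrite (le_lt_trans (ler_norm M))// (lt_trans (archi_boundP (normr_ge0 M)))//.
  by rewrite ltr_nat.
have p0 n : (B < n)%N -> log_pmf n = 0.
  move=> Bn; apply: contrapT => /eqP pn.
  have : n%:R \in supp (distribution log_law X).
    apply: mem_set => e e0; rewrite /distribution /pushforward XE' preimage_id.
    apply: lt_le_trans (symmetric_law_ge _ _ (measurable_ball _ _) (ballxx _ e0)).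
    by rewrite lte_fin divr_gt0// lt_def pn log_pmf_ge0.
  move=> /set_mem /(bM B%:R MB) /=; rewrite normr_nat ler_nat.
  by rewrite leqNgt Bn.
suff big : even_moments_bigO X 1 by have [_] := cramer_M_det fX (lexx 1) big.
apply/eqO_exP; exists 1 => //; exists B => // k Bk /=.
rewrite EX; have /andP[m0 _] := log_law_moment_le k.
rewrite mul1r !ger0_norm ?powR_ge0// (even_moment_law log_pmf_ge0 _ cvg_moments)/=.
rewrite mulr1 -natrM powR_mulrn//.
apply: (cvgr_to_le (@cvg_moments k)); apply: nearW => N.
apply: (@le_trans _ _ (\sum_(0 <= n < N) (2 * k)%:R ^+ (2 * k) * log_pmf n)).
  rewrite /series/=; apply: ler_sum => n _; have [nB|Bn] := leqP n B.
    rewrite mulrC ler_wpM2r ?log_pmf_ge0// lerXn2r ?nnegrE// ler_nat.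
    by rewrite (leq_trans nB)// (leq_trans Bk)// leq_pmull.
  by rewrite p0// mul0r mulr0.
rewrite -mulr_sumr ler_piMr ?exprn_ge0//.
have nd : nondecreasing_seq (series (fun n => log_pmf n * n%:R ^+ (2 * 0))).
  apply/nondecreasing_seqP => n; rewrite /series/= big_nat_recr//= lerDl.
  by rewrite mulr_ge0 ?log_pmf_ge0// exprn_ge0.
have le_lim := nondecreasing_cvgn_le nd (@cvg_moments 0) N.
rewrite (cvg_lim _ (@cvg_log_pmf 0))// -log_weightE divff ?gt_eqF// in le_lim.
apply: le_trans le_lim; rewrite le_eqVlt; apply/orP; left; apply/eqP.
by rewrite /series/=; apply: eq_bigr => n _; rewrite muln0 expr0 mulr1.
Qed.

Lemma exists_boundary_law : exists P Q : probability R R,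
  [/\ finite_moments P (fun x : R => x) /\ finite_moments Q (fun x : R => x),
      (forall k, moment Q (fun x : R => x) k = moment P (fun x : R => x) k),
      Q [set 0] <> P [set 0],
      (forall (X : {RV P >-> R}) (a : R), X =1 (fun x : R => x) ->
         1 < a -> even_moments_bigO X a) &
      (forall X : {RV P >-> R}, X =1 (fun x : R => x) ->
         M_indet X -> ~ bounded_set (supp (distribution P X)))].
Proof.
exists log_law, log_law_twisted; split.
- by split; [exact: log_law_finite_moments|exact: log_law_twisted_finite_moments].
- exact: log_law_same_moments.
- exact: log_law_neq.
- exact: log_law_bigO.
- exact: log_law_unbounded.
Qed.

End boundary_law.

(** * The theorem *)

Theorem theorem3 (R : realType) :
  (* (i) *)
  (forall (d : measure_display) (T : measurableType d) (P : probability T R)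
      (X : {RV P >-> R}) (a : R),
    finite_moments P X ->
    ~ bounded_set (supp (distribution P X)) ->
    0 < a <= 1 ->
    even_moments_bigO X a ->
    cramer P X /\ M_det X)
  /\
  (* (ii) *)
  (forall a : R, 1 < a ->
    ~ (forall (d : measure_display) (T : measurableType d) (P : probability T R)
         (X : {RV P >-> R}),
       finite_moments P X ->
       ~ bounded_set (supp (distribution P X)) ->
       even_moments_bigO X a ->
       M_det X))
  /\
  (exists (d : measure_display) (T : measurableType d) (P : probability T R)
      (X : {RV P >-> R}),
    [/\ finite_moments P X, M_indet X &
        forall a : R, 1 < a -> even_moments_bigO X a]).
Proof.
have [P [Q [[fP fQ] QP Q0 bigP unbP]]] := @exists_boundary_law R.
pose idR : {mfun R >-> R} := HB.pack (fun x : R => x)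
  (isMeasurableFun.Build _ _ _ _ (fun x : R => x) (@measurable_id _ _ setT)).
pose X : {RV P >-> R} := idR.
have indet : M_indet X.
  move=> /(_ Q fQ (fun k _ => QP k) [set 0] (measurable_set1 0)).
  by rewrite /distribution /pushforward /=.
split; [|split].
- by move=> d T P' X' a fX _ /andP[_ a1]; exact: cramer_M_det.
- move=> a a1 /(_ _ _ P X fP (unbP X (fun=> erefl) indet)).
  by move/(_ (bigP X a (fun=> erefl) a1)).
- exists _, _, P, X; split => // a a1; exact: bigP.
Qed.
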